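(* Let $I$ and $J$ be disjoint index sets. A distribution $\nu\in\Sigma^+(I,J)$ is bi-free infinitely divisible if and only if there is a sequence $\{P_{\lambda_n,\nu_n}:n=1,2,\dots\}$ of compound bi-free Poisson distributions determined by $\lambda_n>0$ and $\nu_n\in\Sigma^+(I,J)$ such that $P_{\lambda_n,\nu_n}\to\nu$ weakly as $n\to\infty$.
   Context: $\mathbb{C}\langle X_k:k\in I\sqcup J\rangle$ is the unital $*$-algebra of non-commutative polynomials with $X_k=X_k^*$, and $\Sigma^+(I,J)$ is the set of all positive unital linear functionals on it (positive: $\nu(Q^*Q)\ge0$ for all $Q$). Weak convergence of functionals means pointwise convergence on $\mathbb{C}\langle X_k:k\in I\sqcup J\rangle$. Bi-free cumulants. A non-commutative probability space $(\mathcal{A},\varphi)$ is a unital complex algebra with a unital linear functional. For $\chi:\{1,\dots,n\}\to I\sqcup J$, call the position $k$ left if $\chi(k)\in I$ and right if $\chi(k)\in J$. If the left positions are $i_1<\dots<i_p$ and the right positions are $i_{p+1}>\dots>i_n$, let $s_\chi(k)=i_k$ and $BNC(\chi)=\{s_\chi\cdot\pi:\pi\in NC(n)\}$, where $NC(n)$ is the set of non-crossing partitions of $\{1,\dots,n\}$ and $s_\chi\cdot\pi=\{s_\chi(V):V\in\pi\}$. The bi-free cumulants $\kappa_\chi:\mathcal{A}^n\to\mathbb{C}$ are the multilinear functionals determined recursively by $$\varphi(b_1\cdots b_n)=\sum_{\pi\in BNC(\chi)}\ \prod_{V\in\pi}\kappa_{\chi|_V}\big((b_1,\dots,b_n)|_V\big),\qquad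 b_1,\dots,b_n\in\mathcal{A},$$ where for $V=\{v_1<\dots<v_k\}$ one sets $(b_1,\dots,b_n)|_V=(b_{v_1},\dots,b_{v_k})$ and $\chi|_V$ is viewed as a map on $\{1,\dots,k\}$. For a unital linear functional $\mu$ on $\mathbb{C}\langle X_k:k\in I\sqcup J\rangle$, write $\kappa_{\chi,\mu}=\kappa_\chi(X_{\chi(1)},\dots,X_{\chi(n)})$ computed in $(\mathbb{C}\langle X_k:k\in I\sqcup J\rangle,\mu)$. A two-faced family is a family $((z_i)_{i\in I},(z_j)_{j\in J})$ in $\mathcal{A}$; its distribution is the functional $P\mapsto\varphi(P(z_k:k\in I\sqcup J))$. Two two-faced families $z',z''$ in the same space are bi-free if $\kappa_\chi(z^{\epsilon_1}_{\chi(1)},\dots,z^{\epsilon_n}_{\chi(n)})=0$ for all $n\ge2$, all $\chi:\{1,\dots,n\}\to I\sqcup J$ and all non-constant $\epsilon:\{1,\dots,n\}\to\{',''\}$. The bi-free additive convolution $\mu_1\boxplus\boxplus\mu_2$ is the distribution of $((z'_i+z''_i)_{i\in I},(z'_j+z''_j)_{j\in J})$ where $z',z''$ are bi-free with distributions $\mu_1,\mu_2$; equivalently $\kappa_{\chi,\mu_1\boxplus\boxplus\mu_2}=\kappa_{\chi,\mu_1}+\kappa_{\chi,\mu_2}$ for all $\chi$. A distribution $\nu\in\Sigma^+(I,J)$ is bi-free infinitely divisible if for each $N\in\mathbb{N}$ there is $\nu_{1/N}\in\Sigma^+(I,J)$ with $\nu=\nu_{1/N}\boxplus\boxplus\cdots\boxplus\boxplus\nu_{1/N}$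 ($N$ times). For $\lambda>0$ and $\mu\in\Sigma^+(I,J)$, the compound bi-free Poisson distribution $P_{\lambda,\mu}$ determined by $\lambda$ and $\mu$ is the unique unital linear functional on $\mathbb{C}\langle X_k:k\in I\sqcup J\rangle$ with $\kappa_{\chi,P_{\lambda,\mu}}=\lambda\,\mu(X_{\chi(1)}X_{\chi(2)}\cdots X_{\chi(n)})$ for every $n\in\mathbb{N}$ and $\chi:\{1,\dots,n\}\to I\sqcup J$. *)

(* Defs.v *)
From HB Require Import structures.
From mathcomp Require Import finmap.
From mathcomp.multinomials Require Import monalg.
From mathcomp.real_closed Require Import complex.
From mathcomp Require Import boolp classical_sets reals topology normedtype sequences.
From mathcomp Require Import all_boot all_order all_algebra.

Set Implicit Arguments.
Unset Strict Implicit.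
Unset Printing Implicit Defensive.

Import Order.TTheory GRing.Theory Num.Theory.
Import numFieldNormedType.Exports.

Local Open Scope ring_scope.

(* Non-commutative polynomials are the monoid algebra of the free monoid on the
   index set.  The alias is needed because [{malg S[M]}] only carries an
   [algType] structure when the monoid [M] is commutative. *)
Definition ncpoly (S : comNzRingType) (K : choiceType) := {malg S[{fmonom K}]}.

Section NcPolyAlgebra.
Variables (S : comNzRingType) (K : choiceType).

HB.instance Definition _ :=
  GRing.Lalgebra.copy (ncpoly S K) {malg S[{fmonom K}]}.

Lemma ncpoly_scalerAr (c : S) (P Q : ncpoly S K) : c *: (P * Q) = P * (c *: Q).
Proof.
have cM (T : {malg S[{fmonom K}]}) : T * c%:MP = c%:MP * T.
  rewrite !malgM_def fgmulUg fgmulgU; apply: eq_bigr => k _.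
  by rewrite mul1m mulm1 mulrC.
by rewrite -(mul_malgC c (P * Q)) -(mul_malgC c Q) !mulrA cM.
Qed.

HB.instance Definition _ :=
  GRing.Lalgebra_isAlgebra.Build S (ncpoly S K) ncpoly_scalerAr.

Definition ncX (k : K) : ncpoly S K := << fmu k >>.

Definition nceval (A : algType S) (z : K -> A) (P : ncpoly S K) : A :=
  mmap (in_alg A) (fun w : {fmonom K} => \prod_(k <- w) z k) P.

End NcPolyAlgebra.

(* The conjugate-linear anti-automorphism fixing every [ncX k]. *)
Definition ncstar (R : rcfType) (K : choiceType) (P : ncpoly R[i] K) :
    ncpoly R[i] K :=
  \sum_(w <- msupp P) << (P@_w)^*%C *g FMonom (rev w) >>.

(* Linear functionals on C<X_k : k in I \sqcup J>. *)
Notation ncfunctional R I J := {scalar ncpoly R[i] (I + J)%type}.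

Section BiNonCrossing.
Variable n : nat.

Definition noncrossing (pi : {set {set 'I_n}}) : bool :=
  [forall V in pi, forall W in pi,
     forall a in V, forall b in W, forall c in V, forall d in W,
     [&& a < b, b < c & c < d]%N ==> (V == W)].

Definition NC : {set {set {set 'I_n}}} :=
  [set pi | partition pi [set: 'I_n] & noncrossing pi].

Variables (I J : Type) (chi : 'I_n -> I + J).

Definition is_left (k : 'I_n) : bool := if chi k is inl _ then true else false.

Definition s_seq : seq 'I_n :=
  [seq k <- enum 'I_n | is_left k] ++ rev [seq k <- enum 'I_n | ~~ is_left k].

(* [s_seq] has size [n], so the default value [k] is never used. *)
Definition s_chi (k : 'I_n) : 'I_n := nth k s_seq k.

Definition BNC : {set {set {set 'I_n}}} :=
  [set [set s_chi @: V | V : {set 'I_n} in pi] | pi : {set {set 'I_n}} in NC].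

Lemma size_s_seq : size s_seq = n.
Proof.
rewrite size_cat size_rev !size_filter.
by rewrite count_predC size_enum_ord.
Qed.

Lemma uniq_s_seq : uniq s_seq.
Proof.
rewrite cat_uniq rev_uniq; apply/and3P; split; try exact/filter_uniq/enum_uniq.
apply/hasPn => k; rewrite mem_rev !mem_filter => /andP[kr _].
by rewrite (negbTE kr).
Qed.

Lemma s_chi_inj : injective s_chi.
Proof.
move=> k l; rewrite /s_chi (set_nth_default l); last by rewrite size_s_seq.
move/eqP; rewrite nth_uniq ?size_s_seq ?uniq_s_seq //.
by move/eqP/val_inj.
Qed.

Lemma full_BNC : (0 < n)%N -> [set [set: 'I_n]] \in BNC.
Proof.
move=> n_gt0; apply/imsetP; exists [set [set: 'I_n]].
  rewrite inE; apply/andP; split.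
    apply/and3P; split; first by rewrite /cover big_set1.
      by apply/trivIsetP => V W /set1P-> /set1P->; rewrite eqxx.
    by apply/set1P => /setP/(_ (Ordinal n_gt0)); rewrite !inE.
  apply/forall_inP => V /set1P ->; apply/forall_inP => W /set1P ->.
  by do 4 (apply/forall_inP => ? _); rewrite eqxx implybT.
rewrite imset_set1; congr [set _]; apply/esym/eqP.
by rewrite eqEcard subsetT /= card_imset //; exact: s_chi_inj.
Qed.

Lemma BNC_block (pi : {set {set 'I_n}}) (V : {set 'I_n}) :
  pi \in BNC -> pi != [set [set: 'I_n]] -> V \in pi -> (0 < #|V| < n)%N.
Proof.
case/imsetP => sg; rewrite inE => /andP[/and3P[/eqP cov /trivIsetP tri s0] _].
move=> -> neT /imsetP[W Wsg ->]; rewrite card_imset; last exact: s_chi_inj.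
apply/andP; split.
  by rewrite card_gt0; apply: contraNneq s0 => <-.
have Wn : (#|W| <= n)%N by have := max_card (mem W); rewrite card_ord.
rewrite ltn_neqAle Wn andbT.
apply: contraNneq neT => cW.
have WT : W = setT by apply/eqP; rewrite eqEcard subsetT cardsT card_ord cW /=.
suff -> : sg = [set W].
  rewrite imset_set1 WT; apply/eqP; congr [set _]; apply/eqP.
  by rewrite eqEcard subsetT /= card_imset //; exact: s_chi_inj.
apply/setP => U; rewrite inE; apply/idP/eqP => [Usg|-> //].
apply/eqP/negPn/negP => UW; have := tri _ _ Usg Wsg UW.
rewrite WT -setI_eq0 setIT => /eqP U0.
by move: s0; rewrite -U0 Usg.
Qed.

End BiNonCrossing.

Section Cumulants.
Variables (R : realType) (I J : Type) (A : algType R[i]) (phi : {scalar A}).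

(* The moment-cumulant formula solved for the one-block partition; the first
   argument bounds the depth of the recursion (see [moment_cumulant]).  For a
   set [V] of ordinals, [enum_val] lists the elements of [V] increasingly. *)
Fixpoint cumulant_rec (m n : nat) (chi : 'I_n -> I + J) (b : 'I_n -> A) : R[i] :=
  if m is m'.+1 then
    phi (\prod_(k < n) b k) -
    \sum_(pi in BNC chi | pi != [set [set: 'I_n]]) \prod_(V in pi)
      cumulant_rec m' (fun k : 'I_#|V| => chi (enum_val k))
                      (fun k : 'I_#|V| => b (enum_val k))
  else 0.

Definition cumulant (n : nat) (chi : 'I_n -> I + J) (b : 'I_n -> A) : R[i] :=
  cumulant_rec n chi b.

Lemma cumulant_rec_fuel m n (chi : 'I_n -> I + J) (b : 'I_n -> A) :
  (0 < n <= m)%N -> cumulant_rec m chi b = cumulant chi b.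
Proof.
suff H m1 m2 n1 (c : 'I_n1 -> I + J) (a : 'I_n1 -> A) :
    (0 < n1 <= m1)%N -> (0 < n1 <= m2)%N ->
    cumulant_rec m1 c a = cumulant_rec m2 c a.
  by move=> nm; apply: H => //; case/andP: nm => ->; rewrite leqnn.
elim: m1 m2 n1 c a => [|m1 IH] [|m2] n1 c a; try by case: n1 c a.
case/andP=> n0 n1m1 /andP[_ n1m2] /=; congr (_ - _).
apply: eq_bigr => pi /andP[piB piT]; apply: eq_bigr => V Vpi.
have /andP[V0 Vn] := BNC_block piB piT Vpi.
by apply: IH; rewrite V0 /= -ltnS; apply: leq_trans Vn _.
Qed.

Lemma moment_cumulant n (chi : 'I_n -> I + J) (b : 'I_n -> A) :
  (0 < n)%N ->
  phi (\prod_(k < n) b k) =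
    \sum_(pi in BNC chi) \prod_(V in pi)
      cumulant (fun k : 'I_#|V| => chi (enum_val k))
               (fun k : 'I_#|V| => b (enum_val k)).
Proof.
move=> n_gt0; rewrite (bigD1 [set [set: 'I_n]]) ?full_BNC //= big_set1.
set S := (X in _ = _ + X).
have -> : cumulant (fun k : 'I_#|[set: 'I_n]| => chi (enum_val k))
    (fun k : 'I_#|[set: 'I_n]| => b (enum_val k)) = cumulant chi b.
  have e : #|[set: 'I_n]| = n by rewrite cardsT card_ord.
  have ev (k : 'I_#|[set: 'I_n]|) : enum_val k = cast_ord e k.
    apply: val_inj => /=; rewrite (enum_val_nth (cast_ord e k)) enum_setT.
    by rewrite -enumT nth_enum_ord // (ltn_ord (cast_ord e k)).
  have -> : (fun k : 'I_#|[set: 'I_n]| => chi (enum_val k)) = chi \o cast_ord e.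
    by apply/funext => k; rewrite ev.
  have -> : (fun k : 'I_#|[set: 'I_n]| => b (enum_val k)) = b \o cast_ord e.
    by apply/funext => k; rewrite ev.
  move: (#|_|) e {ev} => m e; subst m; congr cumulant;
    by apply/funext => k /=; rewrite cast_ord_id.
rewrite {1}/cumulant; case: n chi b n_gt0 @S => // n chi b _ S /=.
rewrite -[LHS](subrK S); congr (_ - _ + _).
apply: eq_bigr => pi /andP[piB piT]; apply: eq_bigr => V Vpi.
have /andP[V0 Vn] := BNC_block piB piT Vpi.
by rewrite cumulant_rec_fuel // V0.
Qed.

End Cumulants.

Section BiFree.
Variables (R : realType) (I J : choiceType).

Definition bifree (A : algType R[i]) (phi : {scalar A}) (z1 z2 : I + J -> A) :=
  forall (n : nat) (chi : 'I_n -> I + J) (eps : 'I_n -> bool),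
    (2 <= n)%N -> (exists k l, eps k != eps l) ->
    cumulant phi chi (fun k => if eps k then z2 (chi k) else z1 (chi k)) = 0.

Definition has_distribution (A : algType R[i]) (phi : {scalar A})
    (z : I + J -> A) (mu : ncfunctional R I J) :=
  forall P, mu P = phi (nceval z P).

(* [mu] is the bi-free additive convolution of [mu1] and [mu2]. *)
Definition bifree_conv (mu1 mu2 mu : ncfunctional R I J) : Prop :=
  exists (A : algType R[i]) (phi : {scalar A}) (z1 z2 : I + J -> A),
    [/\ phi 1 = 1, bifree phi z1 z2, has_distribution phi z1 mu1,
        has_distribution phi z2 mu2 &
        has_distribution phi (fun k => z1 k + z2 k) mu].

(* [bifree_conv_pow mu N nu]: [nu] is the [N]-fold convolution of [mu]. *)
Inductive bifree_conv_pow (mu : ncfunctional R I J) :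
    nat -> ncfunctional R I J -> Prop :=
| bifree_conv_pow1 (nu : ncfunctional R I J) :
    (forall P, nu P = mu P) -> bifree_conv_pow mu 1 nu
| bifree_conv_powS (N : nat) (rho nu : ncfunctional R I J) :
    bifree_conv_pow mu N rho -> bifree_conv rho mu nu ->
    bifree_conv_pow mu N.+1 nu.

(* Membership in Sigma^+(I, J); an order [0 <= x] in [R[i]] says that [x] is
   real and non-negative. *)
Definition Sigma_plus (nu : ncfunctional R I J) : Prop :=
  nu 1 = 1 /\ forall Q, 0 <= nu (ncstar Q * Q).

Definition bifree_infinitely_divisible (nu : ncfunctional R I J) : Prop :=
  forall N : nat, (0 < N)%N ->
    exists2 mu, Sigma_plus mu & bifree_conv_pow mu N nu.

(* The condition [0 < n] is needed: the cumulant of the empty word is [0]. *)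
Definition is_compound_bifree_poisson (lambda : R) (mu P : ncfunctional R I J) :=
  P 1 = 1 /\
  forall (n : nat) (chi : 'I_n -> I + J), (0 < n)%N ->
    cumulant P chi (fun k => ncX R[i] (chi k)) =
      lambda%:C%C * mu (\prod_(k < n) ncX R[i] (chi k)).

Definition weak_cvg (P : nat -> ncfunctional R I J) (nu : ncfunctional R I J) :=
  forall Q, ((fun n => P n Q : R[i]^o) @ \oo --> (nu Q : R[i]^o))%classic.

End BiFree.

(* Main.v *)
Require Import Defs.
From HB Require Import structures.
From mathcomp Require Import finmap.
From mathcomp.multinomials Require Import monalg.
From mathcomp.real_closed Require Import complex.
From mathcomp Require Import interval_inference boolp classical_sets reals.
From mathcomp Require Import topology normedtype sequences.
From mathcomp Require Import all_boot all_order all_algebra.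
From mathcomp Require Import ring.

Set Implicit Arguments.
Unset Strict Implicit.
Unset Printing Implicit Defensive.

Import Order.TTheory GRing.Theory Num.Theory.
Import numFieldNormedType.Exports.

Local Open Scope ring_scope.

(** Write [k(w)] for the bi-free cumulant of [nu] along a word [w] in the letters
    [X_i], [X_j].  Bi-free convolution adds cumulants
    ([bifree_conv_cumulant], [bifree_conv_of_cumulant]), so infinite
    divisibility says exactly that, for every [N], the unital functional with
    cumulants [k / N] is positive.

    If [nu] is infinitely divisible with roots [nu_N], then in
    [N * nu_N(w) = N * sum over pi of prod over V of k(w|V) / N] the one-block
    partition contributes [k(w)] and every other partition is [O(1 / N)]
    ([root_moment_cvg]).  Hence the cumulants of the compound Poisson functional
    determined by [N] and [nu_N] converge to those of [nu], and so do its
    moments, which are polynomials in the cumulants.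

    Conversely, let the compound Poisson functionals of [lambda_n], [mu_n]
    converge to [nu].  Cumulants are polynomials in moments, hence
    [lambda_n * mu_n(w)] converges to [k(w)], and the compound Poisson
    functionals of [lambda_n / N], [mu_n] converge to the functional with
    cumulants [k / N].  Positivity survives pointwise limits, so the theorem
    rests on one fact: the compound Poisson functional of any [lambda > 0] and
    any positive [mu] is positive ([compound_poisson_pos]).

    That fact is the existence of a Fock space model.  Let [c = lambda * mu] on
    words.  On the span of finite lists of words, thought of as pure tensors in
    the full Fock space over the polynomials with inner product
    [lambda * mu(q^* p)], a left letter acts on the first tensor factor and a
    right letter on the last one, by creation + annihilation + gauge + constant
    ([fock_step]).  Three things have to be checked.

    - The vacuum moments of these operators are the bi-free moments with
      cumulants [c] ([sum_BNC_fock]).  A bi-non-crossing partition is built by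
      adding the positions from the last to the first.  At each stage some
      blocks are complete and the others are still open; a non-crossing
      partition forces the open ones to lie side by side along the boundary,
      and a new left position can only start a block at the left end of the
      row or join the leftmost open block, afterwards either closing it or
      leaving it open.  These are the four terms of the operator.

    - The operators are symmetric for the Gram kernel of the Fock space
      ([fock_run_adjoint]), so the moment of [u^* v] is the inner product of a
      vector depending on [u] and a vector depending on [v]
      ([fock_moment_gram]).

    - The Gram kernel is positive semidefinite ([fock_gram_psd]): it is built
      from tensor powers of a positive semidefinite kernel, so this is Schur's
      product theorem ([psd_mul]). *)

(** * Non-crossing partitions with open blocks *)

Section Completions.
Variable T : finType.
Implicit Types (lt : rel T) (U V W D h : {set T}) (O : seq {set T}).
Implicit Types (pi : {set {set T}}) (x y : T).

(** Non-crossing partitions relative to an arbitrary strict order, so that right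
    positions can be treated as left positions of the reversed order. *)
Definition noncrossing_for lt pi : bool :=
  [forall V in pi, forall W in pi,
     forall a in V, forall b in W, forall c in V, forall d in W,
     [&& lt a b, lt b c & lt c d] ==> (V == W)].

Lemma noncrossing_forP lt pi :
  reflect (forall V W a b c d, V \in pi -> W \in pi ->
             a \in V -> b \in W -> c \in V -> d \in W ->
             lt a b -> lt b c -> lt c d -> V = W)
          (noncrossing_for lt pi).
Proof.
apply: (iffP idP) => [H V W a b c d Vp Wp aV bW cV dW ab bc cd|H].
  move/forall_inP/(_ _ Vp)/forall_inP/(_ _ Wp)/forall_inP/(_ _ aV): H.
  move/forall_inP/(_ _ bW)/forall_inP/(_ _ cV)/forall_inP/(_ _ dW)/implyP.
  by rewrite ab bc cd => /(_ isT)/eqP.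
apply/forall_inP => V Vp; apply/forall_inP => W Wp; apply/forall_inP => a aV.
apply/forall_inP => b bW; apply/forall_inP => c cV; apply/forall_inP => d dW.
by apply/implyP => /and3P[ab bc cd]; apply/eqP; apply: (H V W a b c d).
Qed.

Lemma noncrossing_for_converse lt pi :
  noncrossing_for (fun x y => lt y x) pi = noncrossing_for lt pi.
Proof.
apply/noncrossing_forP/noncrossing_forP => H V W a b c d Vp Wp aV bW cV dW ab bc cd;
  by apply/esym; apply: (H W V d c b a).
Qed.

Definition seq_cover O : {set T} := [set x | has (fun o : {set T} => x \in o) O].

Lemma seq_coverP O x :
  reflect (exists2 o, o \in O & x \in o) (x \in seq_cover O).
Proof. by rewrite inE; apply: hasP. Qed.

(** The possible futures of a partially built partition: [U] is the set of
    positions still to be added and [O] lists the open blocks as they are now.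
    The last condition says that a block of the finished partition extends at
    most one open block and contains a new position, that is, an open block may
    not stay as it is. *)
Definition completion lt U O pi : bool :=
  [&& partition pi (U :|: seq_cover O), noncrossing_for lt pi &
      [forall V in pi, (V :&: U != set0) && (V :\: U \in set0 :: O)]].

Lemma completionP lt U O pi :
  reflect [/\ forall x, x \in U :|: seq_cover O -> exists2 V, V \in pi & x \in V,
              forall V W x, V \in pi -> W \in pi -> x \in V -> x \in W -> V = W,
              noncrossing_for lt pi
            & forall V, V \in pi -> V :&: U != set0 /\ (V :\: U \in set0 :: O)]
          (completion lt U O pi).
Proof.
apply: (iffP and3P) => [[/and3P[/eqP cov /trivIsetP tri s0] nc /forall_inP H]|].
  split=> //.
  - by move=> x; rewrite -cov => /bigcupP[V Vp xV]; exists V.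
  - move=> V W x Vp Wp xV xW; apply/eqP/negPn/negP => VW.
    have /(_ V W Vp Wp VW) := tri; rewrite -setI_eq0 => /eqP/setP/(_ x).
    by rewrite !inE xV xW.
  - by move=> V /H/andP[].
case=> cov tri nc H; split=> //; last by apply/forall_inP => V /H[-> ->].
apply/and3P; split.
- apply/eqP/setP => x; apply/bigcupP/idP => [[V Vp xV]|/cov[V Vp xV]]; last by exists V.
  have [_] := H V Vp; rewrite in_setU.
  have [//|xU /=] := boolP (x \in U).
  rewrite in_cons => /orP[/eqP/setP/(_ x)|VO]; first by rewrite !inE xV xU.
  by apply/seq_coverP; exists (V :\: U) => //; rewrite inE xU xV.
- apply/trivIsetP => V W Vp Wp; apply: contraR.
  by rewrite -setI_eq0 => /set0Pn[x /setIP[xV xW]]; rewrite (tri V W x).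
- by apply/negP => /H[]; rewrite set0I eqxx.
Qed.

Lemma completion_eq_mem lt U O O' pi : O =i O' ->
  completion lt U O pi = completion lt U O' pi.
Proof.
move=> E; rewrite /completion; congr [&& partition _ (_ :|: _), _ & _].
  by apply/setP => x; rewrite !inE; apply: eq_has_r.
by apply: eq_forallb_in => V _; rewrite !inE E.
Qed.

Lemma setI_D1_notin U V y : y \notin V -> V :&: (U :\ y) = V :&: U.
Proof.
move=> yV; apply/setP => x; rewrite !inE; case: eqP => [->|] //=.
by rewrite (negbTE yV).
Qed.

Lemma setD_D1_notin U V y : y \notin V -> V :\: (U :\ y) = V :\: U.
Proof.
move=> yV; apply/setP => x; rewrite !inE; case: eqP => [->|] //=.
by rewrite (negbTE yV) !andbF.
Qed.

Lemma setD_D1_in U V y : y \in V -> V :\: (U :\ y) = y |: (V :\: U).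
Proof. by move=> yV; apply/setP => x; rewrite !inE; case: eqP => [->|]. Qed.

(** In the next two sections the position [y] is added next to the row [O] of
    open blocks: every open block lies to the right of [y], and every other
    position still to be added lies to the left of [y] or to the right of the
    whole row. *)
Section Step.
Variables (lt : rel T) (U : {set T}) (y : T) (O : seq {set T}).
Hypotheses (lt_irr : irreflexive lt) (lt_trans : transitive lt).
Hypothesis yU : y \in U.
Hypothesis O_U : forall o x, o \in O -> x \in o -> x \notin U.

Let yO o : o \in O -> y \notin o.
Proof. by move=> oO; apply: contraL yU; apply: O_U. Qed.

(** [y] starts a new open block. *)
Lemma completion_create pi :
  completion lt (U :\ y) ([set y] :: O) pi =
  [&& completion lt U O pi, [set y] \notin pi &
      [exists V in pi, (y \in V) && (V \subset U)]].
Proof.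
have cE : (U :\ y) :|: seq_cover ([set y] :: O) = U :|: seq_cover O.
  by apply/setP => x; rewrite !inE /= in_set1; have [->|] := eqVneq x y; rewrite ?yU.
apply/completionP/and3P => [[cov tri nc H]|].
  rewrite cE in cov.
  have HV V : V \in pi -> y \in V -> V \subset U.
    move=> Vp yV; have [_] := H V Vp; rewrite setD_D1_in // !in_cons.
    case/or3P => [/eqP/setP/(_ y)|/eqP E|VO]; first by rewrite !inE eqxx.
      rewrite -setD_eq0; apply/eqP/setP => x; move/setP/(_ x): E.
      rewrite !inE; case: eqP => [->|]; first by rewrite yU.
      by move=> _ /=.
    by have := yO VO; rewrite !inE eqxx.
  split; first apply/completionP; first split=> //.
  - move=> V Vp; have [V1 V2] := H V Vp; split.
      case/set0Pn: V1 => x; rewrite !inE => /and3P[xV xy xU].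
      by apply/set0Pn; exists x; rewrite inE xV.
    have [yV|yV] := boolP (y \in V).
      by move/(HV _ Vp): (yV); rewrite -setD_eq0 => /eqP->; rewrite mem_head.
    move: V2; rewrite setD_D1_notin // !in_cons => /or3P[->//|/eqP/setP/(_ y)|->].
      by rewrite !inE eqxx (negbTE yV) andbF.
    by rewrite orbT.
  - apply/negP => /H[/set0Pn[x]]; rewrite !inE.
    by case: eqP.
  - have [V Vp yV] := cov y ltac:(by rewrite inE yU).
    by apply/exists_inP; exists V => //; rewrite yV HV.
case=> /completionP[cov tri nc H] yp /exists_inP[B Bp /andP[yB BU]].
split; rewrite ?cE // => V Vp.
have [V1 V2] := H V Vp.
have [yV|yV] := boolP (y \in V); last first.
  rewrite setI_D1_notin // setD_D1_notin //; split=> //.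
  by move: V2; rewrite !in_cons => /orP[|] ->; rewrite ?orbT.
have EV : V = B by apply: tri yV yB.
subst V; rewrite setD_D1_in //; move: (BU); rewrite -setD_eq0 => /eqP->.
rewrite setU0 !in_cons eqxx orbT; split=> //.
have : B != [set y] by apply: contraNneq yp => <-.
apply: contraNneq => E; apply/eqP/setP => x; rewrite inE.
apply/idP/eqP => [xB|-> //]; apply/eqP/negPn/negP => xy.
by move/setP/(_ x): E; rewrite !inE xB xy (subsetP BU).
Qed.

(** Closing a block.  With [D] the block completed by [y], adding [D] to a
    partition of the remaining positions cannot create a crossing, since no other
    block has a point between two points of [D]. *)
Lemma completion_add_block (D : {set T}) (O' : seq {set T}) :
  D :&: U = [set y] -> D :\: U \in set0 :: O ->
  (forall o, (o \in O) = (o != set0) && (o == D :\: U) || (o \in O')) ->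
  (forall o z, o \in O' -> z \in o -> z \notin D) ->
  (forall x, x \in (U :\ y) :|: seq_cover O' ->
     (forall d, d \in D -> lt x d) \/ (forall d, d \in D -> lt d x)) ->
  forall pi,
  (completion lt (U :\ y) O' pi -> D \notin pi /\ completion lt U O (D |: pi)) /\
  (completion lt U O pi -> D \in pi -> completion lt (U :\ y) O' (pi :\ D)).
Proof.
move=> DU DO OE O'Dz Dconv pi.
have yD : y \in D by move/setP/(_ y): DU; rewrite !inE eqxx => /andP[].
have inD z : z \in U -> z \in D -> z = y.
  by move=> zU zD; apply/set1P; rewrite -DU inE zD.
have E z : (z \in U :|: seq_cover O) = (z \in D) || (z \in (U :\ y) :|: seq_cover O').
  rewrite !inE; apply/idP/idP.
    case/orP => [zU|/hasP[o]].
      by have [->|zy] := eqVneq z y; rewrite ?yD // zU /= orbT.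
    rewrite OE => /orP[/andP[_ /eqP->]|oO' zo]; first by rewrite inE => /andP[_ ->].
    by apply/orP; right; apply/orP; right; apply/hasP; exists o.
  case/orP => [zD|/orP[/andP[_ -> //]|/hasP[o oO' zo]]].
    have [//|zU /=] := boolP (z \in U).
    apply/hasP; exists (D :\: U); last by rewrite inE zU.
    by rewrite OE eqxx andbT; apply/orP; left; apply/set0Pn; exists z; rewrite inE zU.
  by apply/orP; right; apply/hasP; exists o => //; rewrite OE oO' orbT.
have disj z : z \in (U :\ y) :|: seq_cover O' -> z \notin D.
  rewrite inE => /orP[|/seq_coverP[o oO' zo]]; last exact: O'Dz zo.
  by rewrite !inE => /andP[zy zU]; apply: contraNN zy => zD; rewrite (inD z).
split.
  case/completionP=> cov tri nc H.
  have sub V z : V \in pi -> z \in V -> z \in (U :\ y) :|: seq_cover O'.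
    move=> Vp zV; have [_] := H V Vp; rewrite in_setU.
    have [//|zU] := boolP (z \in U :\ y).
    rewrite in_cons => /orP[/eqP/setP/(_ z)|VO /=].
      by rewrite in_setD zU zV inE.
    by apply/seq_coverP; exists (V :\: (U :\ y)) => //; rewrite in_setD zU.
  have notD V z : V \in pi -> z \in V -> z \notin D by move=> Vp zV; apply/disj/(sub V).
  have Dp : D \notin pi by apply/negP => Dp; have := notD D y Dp yD; rewrite yD.
  split=> //; apply/completionP; split.
  - move=> x; rewrite E => /orP[xD|/cov[V Vp xV]]; first by exists D; rewrite ?setU11.
    by exists V => //; rewrite setU1r.
  - move=> V W x /setU1P[->|Vp] /setU1P[->|Wp] // xV xW.
    + by have := notD W x Wp xW; rewrite xV.
    + by have := notD V x Vp xV; rewrite xW.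
    + exact: tri xV xW.
  - apply/noncrossing_forP => V W a b c d /setU1P[->|Vp] /setU1P[->|Wp] // aV bW cV dW ab bc cd.
    + have [/(_ a aV) ba|/(_ c cV) cb] := Dconv b (sub W b Wp bW).
        by have := lt_trans ab ba; rewrite lt_irr.
      by have := lt_trans bc cb; rewrite lt_irr.
    + have [/(_ b bW) cb|/(_ d dW) dc] := Dconv c (sub V c Vp cV).
        by have := lt_trans bc cb; rewrite lt_irr.
      by have := lt_trans cd dc; rewrite lt_irr.
    + by move/noncrossing_forP: nc => nc; apply: (nc V W a b c d).
  - move=> V /setU1P[->|Vp]; first by split=> //; apply/set0Pn; exists y; rewrite inE yD.
    have [V1 V2] := H V Vp.
    have yV : y \notin V by apply/negP => /(notD V y Vp); rewrite yD.
    move: V1 V2; rewrite setI_D1_notin // setD_D1_notin // => -> V2; split=> //.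
    by move: V2; rewrite !in_cons OE => /orP[->|->] //; rewrite !orbT.
case/completionP=> cov tri nc H Dp.
have notD V z : V \in pi -> V != D -> z \in V -> z \notin D.
  by move=> Vp VD zV; apply: contraNN VD => zD; rewrite (tri V D z).
apply/completionP; split.
- move=> x xE; have [|V Vp xV] := cov x; first by rewrite E xE orbT.
  exists V => //; rewrite in_setD1 Vp andbT.
  by apply/eqP => EV; have := disj x xE; rewrite -EV xV.
- by move=> V W x /setD1P[_ Vp] /setD1P[_ Wp]; apply: tri.
- apply/noncrossing_forP => V W a b c d /setD1P[_ Vp] /setD1P[_ Wp].
  by move/noncrossing_forP: nc => nc; apply: nc.
- move=> V /setD1P[VD Vp]; have [V1 V2] := H V Vp.
  have yV : y \notin V by apply/negP => /(notD V y Vp VD); rewrite yD.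
  rewrite setI_D1_notin // setD_D1_notin //; split=> //; move: V2; rewrite !in_cons OE.
  case/or3P => [->//|/andP[V0 /eqP VDU]|->]; last by rewrite orbT.
  case/set0Pn: V0 => z; rewrite {1}VDU => zDU.
  have := notD V z Vp VD; rewrite -VDU in zDU.
  case/setDP: (zDU) => zV _; rewrite VDU in zDU; case/setDP: zDU => zD _.
  by rewrite zD => /(_ zV).
Qed.

Hypothesis y_O : forall o x, o \in O -> x \in o -> lt y x.
Hypothesis U_y : forall u, u \in U -> u != y ->
  lt u y \/ lt y u /\ forall o x, o \in O -> x \in o -> lt x u.

(** [y] is a block by itself. *)
Lemma completion_add1 pi :
  (completion lt (U :\ y) O pi ->
     [set y] \notin pi /\ completion lt U O ([set y] |: pi)) /\
  (completion lt U O pi -> [set y] \in pi ->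
     completion lt (U :\ y) O (pi :\ [set y])).
Proof.
have D0 : [set y] :\: U = set0 by apply/eqP; rewrite setD_eq0 sub1set.
apply: completion_add_block.
- by apply/setIidPl; rewrite sub1set.
- by rewrite D0 mem_head.
- by move=> o; rewrite D0; case: eqP.
- by move=> o z oO zo; rewrite inE; apply: contraNneq (yO oO) => <-.
- move=> x /setUP[/setD1P[xy xU]|/seq_coverP[o oO xo]].
    by case: (U_y xU xy) => [xly|[ylx _]]; [left|right] => d /set1P->.
  by right=> d /set1P->; apply: y_O xo.
Qed.

End Step.

Section StepMerge.
Variables (lt : rel T) (U : {set T}) (y : T) (h : {set T}) (O : seq {set T}).
Hypotheses (lt_irr : irreflexive lt) (lt_trans : transitive lt).
Hypothesis yU : y \in U.
Hypothesis O_U : forall o x, o \in h :: O -> x \in o -> x \notin U.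
Hypothesis y_O : forall o x, o \in h :: O -> x \in o -> lt y x.
Hypothesis U_y : forall u, u \in U -> u != y ->
  lt u y \/ lt y u /\ forall o x, o \in h :: O -> x \in o -> lt x u.
Hypothesis h_neq0 : h != set0.
Hypothesis O_neq0 : set0 \notin O.
Hypothesis h_O : forall o x z, o \in O -> x \in h -> z \in o -> lt x z.

Let hh : h \in h :: O. Proof. exact: mem_head. Qed.

Let yhDU : (y |: h) :\: U = h.
Proof.
apply/setP => x; rewrite !inE; have [xU|xU] := boolP (x \in U); last first.
  by have [xy|//] := eqVneq x y; rewrite xy yU in xU.
by apply/esym/negbTE; apply: contraL xU; apply: O_U hh.
Qed.

(** [y] closes the first open block. *)
Lemma completion_add_merge pi :
  (completion lt (U :\ y) O pi ->
     (y |: h) \notin pi /\ completion lt U (h :: O) ((y |: h) |: pi)) /\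
  (completion lt U (h :: O) pi -> (y |: h) \in pi ->
     completion lt (U :\ y) O (pi :\ (y |: h))).
Proof.
apply: completion_add_block => //.
- apply/setP => x; rewrite !inE; have [->|xy] := eqVneq x y; first by rewrite yU.
  by apply/negP => /= /andP[xh]; apply/negP/(O_U hh).
- by rewrite yhDU !in_cons eqxx orbT.
- by move=> o; rewrite yhDU in_cons; have [->|] := eqVneq o h; rewrite ?andbF ?h_neq0.
- move=> o z oO zo; rewrite !inE; apply/negP => /orP[/eqP zy|zh].
    by have := @O_U o z; rewrite in_cons oO orbT zo => /(_ isT isT); rewrite zy yU.
  by have := h_O oO zh zo; rewrite lt_irr.
- move=> x /setUP[/setD1P[xy xU]|/seq_coverP[o oO xo]].
    case: (U_y xU xy) => [xly|[ylx xO]]; [left|right] => d /setU1P[->//|dh].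
      by apply: lt_trans xly _; apply: y_O dh.
    exact: xO dh.
  right=> d /setU1P[->|dh]; last exact: h_O xo.
  by apply: y_O xo; rewrite in_cons oO orbT.
Qed.

(** [y] joins the first open block [h] and leaves it open.  Why only the first
    one: if [y] joined a later block [o], then the block extending [h], which
    has to reach a position outside the row, would cross the block of [y]. *)
Lemma completion_merge pi :
  completion lt (U :\ y) ((y |: h) :: O) pi =
  [&& completion lt U (h :: O) pi, (y |: h) \notin pi &
      ~~ [exists V in pi, (y \in V) && (V \subset U)]].
Proof.
have yh : y \notin h by apply: contraL yU; apply: O_U hh.
have cE : (U :\ y) :|: seq_cover ((y |: h) :: O) = U :|: seq_cover (h :: O).
  by apply/setP => x; rewrite !inE /= in_setU1; have [->|] := eqVneq x y; rewrite ?yU.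
have yO o : o \in O -> y \notin o.
  by move=> oO; apply: contraL yU; apply: O_U; rewrite in_cons oO orbT.
have set0h : set0 \notin h :: O by rewrite in_cons negb_or eq_sym h_neq0.
apply/completionP/and3P => [[cov tri nc H]|].
  rewrite cE in cov.
  have HV V : V \in pi -> y \in V -> V :\: U = h.
    move=> Vp yV; have [_] := H V Vp; rewrite setD_D1_in // !in_cons.
    case/or3P => [/eqP/setP/(_ y)|/eqP E|VO]; first by rewrite !inE eqxx.
      apply/setP => x; move/setP/(_ x): E; rewrite !inE; case: eqP => [->|//].
      by rewrite yU (negbTE yh).
    by have := yO _ VO; rewrite !inE eqxx.
  split; first apply/completionP; first split=> //.
  - move=> V Vp; have [V1 V2] := H V Vp; split.
      case/set0Pn: V1 => x; rewrite !inE => /and3P[xV xy xU].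
      by apply/set0Pn; exists x; rewrite inE xV.
    have [yV|yV] := boolP (y \in V); first by rewrite HV // !in_cons eqxx orbT.
    move: V2; rewrite setD_D1_notin // !in_cons => /or3P[->//|/eqP/setP/(_ y)|->].
      by rewrite !inE eqxx (negbTE yV) andbF.
    by rewrite !orbT.
  - apply/negP => /H[/set0Pn[x]]; rewrite !inE.
    by case: eqP => //= _; case: (boolP (x \in h)) => //= /(O_U hh)/negbTE->.
  - apply/exists_inP => -[V Vp /andP[yV]]; rewrite -setD_eq0 HV //.
    by rewrite (negbTE h_neq0).
case=> /completionP[cov tri nc H] yp /exists_inP ex.
split; rewrite ?cE // => V Vp.
have [V1 V2] := H V Vp.
have [yV|yV] := boolP (y \in V); last first.
  rewrite setI_D1_notin // setD_D1_notin //; split=> //.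
  move: V2; rewrite !in_cons => /or3P[->|/eqP VDU|->]; rewrite ?orbT //.
  (* V extends h and avoids y; the block B of y extends some other open block o,
     and V and B cross because V also contains a new position p. *)
  have [B Bp yB] := cov y ltac:(by rewrite inE yU).
  have [_] := H B Bp; rewrite !in_cons => /or3P[BU|/eqP BDU|BO].
  - by case: ex; exists B; rewrite // yB -setD_eq0.
  - case/set0Pn: h_neq0 => z zh.
    have zB : z \in B by move: zh; rewrite -BDU inE => /andP[].
    have zV : z \in V by move: zh; rewrite -VDU inE => /andP[].
    by rewrite (tri V B z) ?yB in yV.
  - have BV : B = V; last by rewrite -BV yB in yV.
    case/set0Pn: h_neq0 => v vh.
    have vV : v \in V by move: vh; rewrite -VDU inE => /andP[].
    have [o oBU] : exists o, o \in B :\: U.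
      by apply/set0Pn; apply: contraNneq O_neq0 => <-.
    have oB : o \in B by case/setDP: oBU.
    have [p /setIP[pV pU]] := set0Pn _ V1.
    have py : p != y by apply: contraNneq yV => <-.
    have vo : lt v o by apply: h_O vh oBU.
    have yv : lt y v by apply: y_O vh.
    move/noncrossing_forP: nc => nc.
    case: (U_y pU py) => [ply|[ylp pO]]; first by apply/esym; apply: (nc V B p y v o).
    by apply: (nc B V y v o p) => //; apply: pO oBU; rewrite in_cons BO orbT.
have VDU : V :\: U = h.
  move: V2; rewrite !in_cons => /or3P[VU|/eqP//|VO].
    by case: ex; exists V; rewrite // yV -setD_eq0.
  have [v vh] := set0Pn _ h_neq0.
  have [W Wp vW] : exists2 W, W \in pi & v \in W.
    by apply: cov; rewrite inE; apply/orP; right; apply/seq_coverP; exists h.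
  have [o oVU] : exists o, o \in V :\: U.
    by apply/set0Pn; apply: contraNneq O_neq0 => <-.
  have oV : o \in V by case/setDP: oVU.
  have vo : lt v o by apply: h_O vh oVU.
  have yv : lt y v by apply: y_O vh.
  have WV : W = V.
    have [/set0Pn[p /setIP[pW pU]] _] := H W Wp.
    have [pe|py] := eqVneq p y; first by rewrite pe in pW; apply: tri pW yV.
    move/noncrossing_forP: nc => nc.
    case: (U_y pU py) => [ply|[ylp pO]]; first by apply: (nc W V p y v o).
    by apply/esym; apply: (nc V W y v o p) => //; apply: pO oVU; rewrite in_cons VO orbT.
  have : v \in V :\: U by rewrite inE (O_U hh vh) -WV.
  by move=> vVU; have := h_O VO vh vVU; rewrite lt_irr.
rewrite setD_D1_in // VDU !in_cons eqxx orbT; split=> //.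
have : V != y |: h by apply: contraNneq yp => <-.
apply: contraNneq => E; apply/eqP/setP => x; rewrite in_setU1.
have [->|xy] := eqVneq x y; first by rewrite yV.
apply/idP/idP => [xV|]; last by rewrite -VDU inE => /andP[].
rewrite -VDU inE xV andbT; apply/negP => xU.
by move/setP/(_ x): E; rewrite !inE xy xV xU.
Qed.

End StepMerge.

Section Sum.
Variables (C : comPzRingType) (f : {set T} -> C).

Definition completion_sum lt U O : C :=
  \sum_(pi | completion lt U O pi) \prod_(V in pi) f V.

Lemma completion_sum_eq_mem lt U O O' : O =i O' ->
  completion_sum lt U O = completion_sum lt U O'.
Proof. by move=> E; apply: eq_bigl => pi; apply: completion_eq_mem. Qed.

Lemma completion_sum_converse lt U O :
  completion_sum (fun x y => lt y x) U O = completion_sum lt U O.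
Proof.
by apply: eq_bigl => pi; rewrite /completion noncrossing_for_converse.
Qed.

Lemma completion_sum_block lt U O U' O' D :
  (forall pi,
    (completion lt U' O' pi -> D \notin pi /\ completion lt U O (D |: pi)) /\
    (completion lt U O pi -> D \in pi -> completion lt U' O' (pi :\ D))) ->
  \sum_(pi | completion lt U O pi && (D \in pi)) \prod_(V in pi) f V =
  f D * completion_sum lt U' O'.
Proof.
move=> H; rewrite (reindex_onto (fun pi => D |: pi) (fun pi => pi :\ D)) /=; last first.
  by move=> pi /andP[_ Dp]; rewrite setD1K.
rewrite mulr_sumr; apply: eq_big => [pi|pi].
  apply/idP/idP => [/andP[/andP[c _] /eqP E]|c].
    by have [_ /(_ c)] := H (D |: pi); rewrite setU11 E; apply.
  have [/(_ c)[Dp c'] _] := H pi; rewrite c' setU11 /=.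
  by rewrite setU1K.
case/andP=> _ /eqP E; have Dp : D \notin pi by rewrite -E !inE eqxx.
by rewrite big_setU1.
Qed.

(** The four ways of adding [y]: the recursion satisfied by a Fock space operator
    acting on the first tensor factor. *)
Lemma completion_sum_step lt U O y :
  irreflexive lt -> transitive lt -> y \in U ->
  (forall o x, o \in O -> x \in o -> x \notin U) ->
  (forall o x, o \in O -> x \in o -> lt y x) ->
  (forall u, u \in U -> u != y ->
     lt u y \/ lt y u /\ forall o x, o \in O -> x \in o -> lt x u) ->
  set0 \notin O ->
  pairwise (fun o o' : {set T} => [forall x in o, forall z in o', lt x z]) O ->
  completion_sum lt U O =
    completion_sum lt (U :\ y) ([set y] :: O)
    + f [set y] * completion_sum lt (U :\ y) O
    + (if O is h :: O' then
         completion_sum lt (U :\ y) ((y |: h) :: O')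
         + f (y |: h) * completion_sum lt (U :\ y) O'
       else 0).
Proof.
move=> lt_irr lt_trans yU O_U y_O U_y O0 pw.
rewrite {1}/completion_sum (bigID (fun pi => [set y] \in pi)) /=.
rewrite (completion_sum_block (U' := U :\ y) (O' := O)); last first.
  by apply: completion_add1.
rewrite [_ * _ + _]addrC -addrA [_ * _ + _]addrC addrA; congr (_ + _).
rewrite (bigID (fun pi : {set {set T}} => [exists V in pi, (y \in V) && (V \subset U)])) /=.
congr (_ + _).
  by apply: eq_bigl => pi; rewrite completion_create // andbA.
case: O O_U y_O U_y O0 pw => [|h O] O_U y_O U_y O0 pw.
  apply: big_pred0 => pi; apply/negP => /andP[/andP[/completionP[cov _ _ H] _]].
  case/exists_inP; have [B Bp yB] := cov y ltac:(by rewrite inE yU).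
  exists B => //; have [_] := H B Bp; rewrite mem_seq1 setD_eq0 yB.
  by move->.
move: O0; rewrite in_cons negb_or eq_sym => /andP[h0 O0].
have h_O o x z : o \in O -> x \in h -> z \in o -> lt x z.
  case/andP: pw => /allP pw _ oO xh zo.
  by move/forall_inP: (pw o oO) => /(_ x xh)/forall_inP/(_ z zo).
have yh : y \notin h by apply: contraL yU; apply: O_U; rewrite mem_head.
rewrite (bigID (fun pi => (y |: h) \in pi)) /= addrC; congr (_ + _).
  apply: eq_bigl => pi; rewrite completion_merge //.
  case: (completion _ _ _ _) => //=.
  case ex : [exists _ in _, _]; first by rewrite !andbF.
  rewrite !andbT.
  suff -> : [set y] \notin pi by [].
  apply: contraFN ex => yp; apply/exists_inP; exists [set y] => //.
  by rewrite inE eqxx sub1set.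
rewrite -(completion_sum_block (U := U) (O := h :: O) (D := y |: h)); last first.
  by apply: completion_add_merge.
apply: eq_bigl => pi; case cp: (completion _ _ _ _) => //=.
have [yhp|] := boolP (y |: h \in pi); rewrite ?andbF // andbT.
have [_ tri _ _] := completionP _ _ _ _ cp.
have [z zh] := set0Pn _ h0.
have zU : z \notin U by apply: O_U zh; rewrite mem_head.
apply/andP; split.
  apply/negP => yp; have /setP/(_ z) : [set y] = y |: h.
    by apply: (tri _ _ y) => //; rewrite !inE eqxx.
  by rewrite !inE zh orbT; apply/negP; apply: contraNneq yh => <-.
apply/exists_inP => -[V Vp /andP[yV VU]].
have VE : V = y |: h by apply: (tri _ _ y) => //; rewrite !inE eqxx.
by move/subsetP/(_ z): VU; rewrite VE !inE zh orbT (negbTE zU) => /(_ isT).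
Qed.

Lemma completion_sum0 lt O : set0 \notin O ->
  completion_sum lt set0 O = (O == [::])%:R.
Proof.
move=> O0; have comp0 pi : completion lt set0 O pi = (pi == set0) && (O == [::]).
  apply/completionP/andP => [[cov _ _ H]|[/eqP-> /eqP->]]; last first.
    split=> [x|V W x|//|V]; rewrite ?inE //.
    by apply/noncrossing_forP => V W a b c d; rewrite inE.
  have p0 : pi = set0.
    by apply/setP => V; rewrite inE; apply/negP => /H[]; rewrite setI0 eqxx.
  split; first exact/eqP.
  case: O O0 cov {H} => [//|o O]; rewrite in_cons negb_or eq_sym => /andP[/set0Pn[x xo] _].
  case/(_ x) => [|V]; last by rewrite p0 inE.
  by rewrite inE; apply/orP; right; apply/seq_coverP; exists o; rewrite ?mem_head.
rewrite /completion_sum (eq_bigl _ _ comp0); case: eqP => _ /=; last first.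
  by rewrite big_pred0 // => pi; rewrite andbF.
by rewrite (big_pred1 set0) ?big_set0 // => pi; rewrite andbT.
Qed.

Lemma completion_sumT lt :
  completion_sum lt setT [::] =
  \sum_(pi | partition pi [set: T] && noncrossing_for lt pi) \prod_(V in pi) f V.
Proof.
apply: eq_bigl => pi; rewrite /completion setTU.
case pT : (partition _ _) => //=; case: (noncrossing_for _ _) => //=.
apply/forall_inP => V Vp; rewrite setIT setDT mem_head andbT.
by case/and3P: pT => _ _; apply: contraNneq => <-.
Qed.

End Sum.
End Completions.

(** * Operators on a Fock space of words *)

Section Fock.
Variables (K : Type) (left : pred K) (C : comNzRingType).
Implicit Types (c : seq K -> C) (x : K) (w u v : seq K) (O P : seq (seq K)).
Implicit Types (F : seq (seq K) -> C) (G : seq (seq K) -> seq (seq K) -> C).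

(** The transpose of the operator of a left letter, that is, its action on linear
    functionals [F] evaluated at a pure tensor [O]: creation, constant, gauge,
    annihilation.  Working with functionals on pure tensors avoids introducing
    the span of the tensors. *)
Definition fock_left c x F O : C :=
  F ([:: x] :: O) + c [:: x] * F O
  + (if O is h :: O' then F ((x :: h) :: O') + c (x :: h) * F O' else 0).

Definition fock_step c x F O : C :=
  if left x then fock_left c x F O
  else fock_left c x (fun O' => F (rev O')) (rev O).

Fixpoint fock_run c w F O : C :=
  if w is x :: w' then fock_step c x (fock_run c w' F) O else F O.

(** Inner product of two pure tensors, for [c(u^* v)] as inner product of words. *)
Definition fock_gram c P O : C :=
  if size P == size O then \prod_(po <- zip P O) c (rev po.1 ++ po.2) else 0.

Lemma eq_fock_left c x F F' O : F =1 F' -> fock_left c x F O = fock_left c x F' O.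
Proof. by move=> E; rewrite /fock_left; case: O => *; rewrite !E. Qed.

Lemma eq_fock_step c x F F' O : F =1 F' -> fock_step c x F O = fock_step c x F' O.
Proof.
by move=> E; rewrite /fock_step; case: ifP => _; apply: eq_fock_left => ?; rewrite E.
Qed.

Lemma eq_fock_run c w F F' O : F =1 F' -> fock_run c w F O = fock_run c w F' O.
Proof. by move=> E; elim: w O => [|x w IH] O /=; [exact: E|exact: eq_fock_step]. Qed.

Lemma fock_run_cat c u v F O :
  fock_run c (u ++ v) F O = fock_run c u (fock_run c v F) O.
Proof. by elim: u O => //= x u IH O; apply: eq_fock_step. Qed.

(** Linear combinations of pure tensors, as lists of pairs. *)
Definition fock_eval (s : seq (C * seq (seq K))) F : C := \sum_(p <- s) p.1 * F p.2.

Definition scale_vect (a : C) (s : seq (C * seq (seq K))) :=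
  [seq (a * p.1, p.2) | p <- s].

Definition left_vect c x O : seq (C * seq (seq K)) :=
  (1, [:: x] :: O) :: (c [:: x], O) ::
  (if O is h :: O' then [:: (1, (x :: h) :: O'); (c (x :: h), O')] else [::]).

Definition step_vect c x O :=
  if left x then left_vect c x O
  else [seq (p.1, rev p.2) | p <- left_vect c x (rev O)].

Fixpoint run_vect c w O : seq (C * seq (seq K)) :=
  if w is x :: w' then
    flatten [seq scale_vect p.1 (run_vect c w' p.2) | p <- step_vect c x O]
  else [:: (1, O)].

Lemma left_vectE c x F O : fock_left c x F O = fock_eval (left_vect c x O) F.
Proof.
rewrite /fock_left /fock_eval /left_vect; case: O => [|h O];
  rewrite !big_cons big_nil /=; ring.
Qed.

Lemma step_vectE c x F O : fock_step c x F O = fock_eval (step_vect c x O) F.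
Proof.
rewrite /fock_step /step_vect; case: ifP => _; rewrite left_vectE //.
by rewrite /fock_eval big_map.
Qed.

Lemma run_vectE c w F O : fock_run c w F O = fock_eval (run_vect c w O) F.
Proof.
elim: w O => [|x w IH] O /=; first by rewrite /fock_eval big_seq1 mul1r.
rewrite step_vectE /fock_eval big_flatten big_map; apply: eq_bigr => p _.
by rewrite IH /fock_eval /scale_vect big_map mulr_sumr; apply: eq_bigr => q _; rewrite mulrA.
Qed.

(** Operators acting on different variables of a two-variable functional commute. *)
Lemma fock_run_exchange c c' u v G P O :
  fock_run c u (fun O' => fock_run c' v (fun P' => G P' O') P) O =
  fock_run c' v (fun P' => fock_run c u (G P') O) P.
Proof.
rewrite !run_vectE /fock_eval.
under eq_bigr => p _ do rewrite run_vectE mulr_sumr.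
rewrite exchange_big /=; apply: eq_bigr => q _; rewrite run_vectE mulr_sumr.
by apply: eq_bigr => p _; rewrite mulrCA.
Qed.

Lemma fock_gram_rev c P O : fock_gram c (rev P) (rev O) = fock_gram c P O.
Proof.
rewrite /fock_gram !size_rev; case: eqP => // E.
by rewrite -rev_zip // big_rev.
Qed.

Let crev c := c \o rev.

(** Symmetry of the operator: creation is adjoint to annihilation, gauge and
    constant are self-adjoint.  The coefficients on the left variable are those
    of [c \o rev], the conjugate of [c] when [c] is hermitian. *)
Lemma fock_left_adjoint c x P O :
  fock_left c x (fock_gram c P) O = fock_left (crev c) x (fun P' => fock_gram c P' O) P.
Proof.
rewrite /fock_left /crev /fock_gram.
case: P O => [|p P] [|o O] /=; rewrite ?eqSS ?big_cons ?big_nil ?eqxx /=.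
- ring.
- by case: O => [|? ?] /=; rewrite ?big_nil; ring.
- by case: P => [|? ?] /=; rewrite ?big_nil !rev_cons ?cats0 ?cats1; ring.
rewrite !rev_cons !cat_rcons !cats1.
case: (eqVneq (size P) (size O)) => [->|_].
  rewrite ![_ == _.+1]eq_sym ![_.+1 == _]gtn_eqF //; ring.
case: (size P == _.+1); case: (_.+1 == size O); ring.
Qed.

Lemma fock_step_adjoint c x P O :
  fock_step c x (fock_gram c P) O =
  fock_step (crev c) x (fun P' => fock_gram c P' O) P.
Proof.
rewrite /fock_step; case: ifP => _; first exact: fock_left_adjoint.
rewrite -(@eq_fock_left c x (fock_gram c (rev P))); last first.
  by move=> O' /=; rewrite -[in RHS](revK P) fock_gram_rev.
rewrite fock_left_adjoint; apply: eq_fock_left => P' /=.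
by rewrite -[in RHS](revK O) fock_gram_rev.
Qed.

Lemma fock_run_adjoint c u P O :
  fock_run c u (fock_gram c P) O =
  fock_run (crev c) (rev u) (fun P' => fock_gram c P' O) P.
Proof.
elim: u P O => [|x u IH] P O //=.
rewrite (eq_fock_step _ _ _ (F' := fun O' =>
  fock_run (crev c) (rev u) (fun P' => fock_gram c P' O') P)); last by move=> O'; exact: IH.
have := fock_run_exchange c (crev c) [:: x] (rev u) (fock_gram c) P O.
rewrite /= => ->; rewrite rev_cons -cats1 fock_run_cat; apply: eq_fock_run => P' /=.
exact: fock_step_adjoint.
Qed.

(** The vacuum is the empty tensor; the last letter of a word acts first. *)
Definition fock_moment c w : C := fock_run c (rev w) (fock_gram c [::]) [::].

(** Moving the letters of [u^*] to the other side of the inner product. *)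
Lemma fock_moment_gram c u v :
  fock_moment c (rev u ++ v) =
  \sum_(p <- run_vect (crev c) (rev u) [::]) \sum_(q <- run_vect c (rev v) [::])
     p.1 * q.1 * fock_gram c p.2 q.2.
Proof.
rewrite /fock_moment rev_cat revK fock_run_cat.
rewrite (eq_fock_run _ _ _ (F' := fun O =>
  fock_run (crev c) (rev u) (fun P => fock_gram c P O) [::])); last first.
  by move=> O; apply: fock_run_adjoint.
rewrite fock_run_exchange run_vectE; apply: eq_bigr => p _.
by rewrite run_vectE mulr_sumr; apply: eq_bigr => q _; rewrite mulrA.
Qed.

Lemma fock_gram_vac c O : fock_gram c [::] O = (nilp O)%:R.
Proof. by case: O => [|o O]; rewrite /fock_gram //= big_nil. Qed.

End Fock.

(** * Bi-non-crossing sums are vacuum expectations *)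

Section BoundaryOrder.
Variables (n : nat) (lf : pred 'I_n).

(** The order of the positions along the boundary of a bi-non-crossing diagram:
    down the left side, then up the right side.  It is the image of the order of
    the indices under [s_chi]. *)
Definition boundary_lt : rel 'I_n := fun k l =>
  if lf k then (if lf l then k < l else true)%N
  else (if lf l then false else l < k)%N.

Lemma boundary_lt_irr : irreflexive boundary_lt.
Proof. by move=> k; rewrite /boundary_lt; case: (lf k); rewrite ltnn. Qed.

Lemma boundary_lt_trans : transitive boundary_lt.
Proof.
move=> b a d; rewrite /boundary_lt.
case: (lf a); case: (lf b); case: (lf d) => //.
  exact: ltn_trans.
by move=> ba db; apply: ltn_trans db ba.
Qed.

End BoundaryOrder.

Lemma sorted_ltn_enum n (V : {set 'I_n}) :
  sorted (fun i j : 'I_n => (i < j)%N) (enum V).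
Proof.
rewrite {1}/enum_mem -enumT; apply: sorted_filter => [a b d|]; first exact: ltn_trans.
by have := iota_ltn_sorted 0 n; rewrite -val_enum_ord sorted_map.
Qed.

Lemma enum_setU1_lt n (y : 'I_n) (V : {set 'I_n}) :
  (forall x, x \in V -> y < x)%N -> enum (y |: V) = y :: enum V.
Proof.
move=> yV; apply: (@irr_sorted_eq _ (fun i j : 'I_n => (i < j)%N)).
- by move=> a b d; apply: ltn_trans.
- by move=> a; apply: ltnn.
- exact: sorted_ltn_enum.
- rewrite /= path_min_sorted ?sorted_ltn_enum //.
  by apply/allP => x; rewrite mem_enum; apply: yV.
- by move=> x; rewrite in_cons !mem_enum in_setU1.
Qed.

Section OpenBlocks.
Variable n : nat.
Implicit Types (lt : rel 'I_n) (t : nat) (O : seq {set 'I_n}).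

Definition blocks_lt lt (o o' : {set 'I_n}) :=
  [forall x in o, forall z in o', lt x z].

Lemma blocks_ltP lt (o o' : {set 'I_n}) :
  reflect (forall x z, x \in o -> z \in o' -> lt x z) (blocks_lt lt o o').
Proof.
apply: (iffP forall_inP) => [H x z xo zo|H x xo].
  by move/forall_inP: (H x xo); apply.
by apply/forall_inP => z; apply: H.
Qed.

(** The invariant of the construction once the positions from [t] on have been
    added: the open blocks form a row. *)
Definition open_blocks lt t O :=
  [/\ set0 \notin O, forall (o : {set 'I_n}) x, o \in O -> x \in o -> (t <= x)%N
    & pairwise (blocks_lt lt) O].

Lemma open_blocks_rev lt t O :
  open_blocks lt t O <-> open_blocks (fun x y => lt y x) t (rev O).
Proof.
have pwE : pairwise (blocks_lt (fun x y => lt y x)) (rev O) = pairwise (blocks_lt lt) O.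
  elim: O => //= o O IH; rewrite rev_cons pairwise_rcons IH all_rev; congr (_ && _).
  by apply: eq_all => o'; apply/blocks_ltP/blocks_ltP => H x z xo zo; apply: H.
split=> -[O0 Ot pw]; (split; [by rewrite mem_rev in O0 *| |by rewrite pwE in pw *]).
  by move=> o x; rewrite mem_rev; apply: Ot.
by move=> o x oO; apply: Ot; rewrite mem_rev.
Qed.

Definition letters_below t : {set 'I_n} := [set k : 'I_n | (k < t)%N].

Variables (K : Type) (l : 'I_n -> K) (C : comNzRingType) (c : seq K -> C).
Definition word_on (V : {set 'I_n}) : seq K := [seq l k | k <- enum V].
Let f V := c (word_on V).

(** As the position [y] precedes the positions already added, adjoining it to a
    block puts its letter in front of the word of that block. *)
Lemma completion_sum_fock_left lt (y : 'I_n) (F : seq (seq K) -> C) :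
  irreflexive lt -> transitive lt ->
  (forall x : 'I_n, (y < x)%N -> lt y x) ->
  (forall u : 'I_n, (u < y)%N ->
     lt u y \/ lt y u /\ forall x : 'I_n, (y < x)%N -> lt x u) ->
  (forall O, open_blocks lt y O ->
     completion_sum f lt (letters_below y) O = F (map word_on O)) ->
  forall O, open_blocks lt y.+1 O ->
    completion_sum f lt (letters_below y.+1) O =
    fock_left c (l y) F (map word_on O).
Proof.
move=> irr tr ylt ult HF O [O0 Ot pw].
have UE : letters_below y.+1 :\ y = letters_below y.
  by apply/setP => k; rewrite !inE ltnS [RHS]ltn_neqAle.
have Ot' o x : o \in O -> x \in o -> (y <= x)%N by move=> oO xo; apply/ltnW/(Ot o).
have word1 : word_on [set y] = [:: l y] by rewrite /word_on enum_set1.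
have set1N0 : set0 != [set y] by rewrite eq_sym; apply/set0Pn; exists y; rewrite inE.
rewrite (completion_sum_step _ (y := y)) //; last 4 first.
- by rewrite inE.
- by move=> o x oO xo; rewrite inE -leqNgt (Ot o).
- by move=> o x oO xo; apply/ylt/(Ot o).
- move=> u; rewrite inE ltnS leq_eqVlt => /orP[/eqP/val_inj->|uy _]; first by rewrite eqxx.
  case: (ult u uy) => [|[yu H]]; [by left|right].
  by split=> // o x oO xo; apply/H/(Ot o).
rewrite UE !HF /=; last 2 first.
- by split.
- split.
  + by rewrite in_cons negb_or set1N0.
  + by move=> o x; rewrite in_cons => /orP[/eqP->|oO]; [rewrite inE => /eqP->|apply: Ot'].
  + rewrite /= pw andbT; apply/allP => o oO; apply/blocks_ltP => x z /set1P-> zo.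
    by apply/ylt/(Ot o).
rewrite /fock_left {1 2}/f word1; congr (_ + _ + _).
case: O O0 Ot pw Ot' => //= h O O0 Ot /andP[/allP pwh pw] Ot'.
move: O0; rewrite in_cons negb_or => /andP[h0 O0].
have wE : word_on (y |: h) = l y :: word_on h.
  rewrite /word_on enum_setU1_lt // => x xh; apply: (Ot h) => //.
  by rewrite mem_head.
rewrite !HF /= /f ?wE //; split=> //.
- by move=> o x oO; apply: Ot'; rewrite in_cons oO orbT.
- rewrite in_cons negb_or O0 andbT eq_sym; apply/set0Pn; exists y.
  by rewrite setU11.
- move=> o x; rewrite in_cons => /orP[/eqP->|oO]; last first.
    by apply: Ot'; rewrite in_cons oO orbT.
  by case/setU1P => [->//|]; apply: Ot'; rewrite mem_head.
- rewrite /= pw andbT; apply/allP => o oO; apply/blocks_ltP => x z.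
  case/setU1P => [->|xh] zo; first by apply/ylt/(Ot o) => //; rewrite in_cons oO orbT.
  by move/blocks_ltP: (pwh o oO); apply.
Qed.

Variable lf : pred K.
Let lt := boundary_lt (fun k => lf (l k)).

(** A right position is a left position for the reversed boundary order, with the
    row of open blocks read backwards. *)
Lemma completion_sum_fock_run t O : (t <= n)%N -> open_blocks lt t O ->
  completion_sum f lt (letters_below t) O =
  fock_run lf c (rev (take t (map l (enum 'I_n)))) (fock_gram c [::])
    (map word_on O).
Proof.
elim: t O => [|t IH] O tn Oo.
  rewrite take0 /= fock_gram_vac.
  have -> : letters_below 0 = set0 by apply/setP => k; rewrite !inE.
  rewrite completion_sum0; last by case: Oo.
  by case: O {Oo}.
pose y := Ordinal tn.
rewrite (take_nth (l y)); last by rewrite size_map size_enum_ord.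
rewrite rev_rcons.
rewrite (nth_map y) ?size_enum_ord //.
have -> : nth y (enum 'I_n) t = y by apply: val_inj; rewrite /= nth_enum_ord.
rewrite /= /fock_step; case: ifP => ly.
  apply: (@completion_sum_fock_left lt y) => //.
  - exact: boundary_lt_irr.
  - exact: boundary_lt_trans.
  - by move=> x yx; rewrite /lt /boundary_lt ly yx; case: ifP.
  - move=> u uy; rewrite /lt /boundary_lt ly uy; case: (lf (l u)); [by left|right].
    by split=> // x yx; rewrite (ltn_trans uy yx); case: ifP.
  - by move=> O' Oo'; apply: IH => //; apply: ltnW.
rewrite -map_rev -(completion_sum_eq_mem _ _ _ (mem_rev O)) -completion_sum_converse.
apply: (@completion_sum_fock_left (fun x z => lt z x) y).
- exact: boundary_lt_irr.
- by move=> a b d ab bd; apply: boundary_lt_trans bd ab.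
- by move=> x yx; rewrite /lt /boundary_lt ly yx; case: ifP.
- move=> u uy; rewrite /lt /boundary_lt ly uy; case: (lf (l u)); last by left.
  right; split=> // x yx; case: ifP => // _.
  exact: ltn_trans uy yx.
- move=> O' Oo'; rewrite completion_sum_converse -(completion_sum_eq_mem _ _ _ (mem_rev O')).
  rewrite IH ?map_rev //; first exact: ltnW.
  by apply/open_blocks_rev; rewrite revK.
exact: (proj1 (open_blocks_rev _ _ _) Oo).
Qed.

(** Nothing added and nothing open: all non-crossing partitions are completions. *)
Lemma noncrossing_sum_fock :
  \sum_(pi | partition pi [set: 'I_n] && noncrossing_for lt pi)
     \prod_(V in pi) f V = fock_moment lf c (map l (enum 'I_n)).
Proof.
rewrite -completion_sumT /fock_moment.
have -> : [set: 'I_n] = letters_below n.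
  by apply/setP => k; rewrite !inE ltn_ord.
rewrite completion_sum_fock_run //.
by rewrite take_oversize // size_map size_enum_ord.
Qed.

End OpenBlocks.

Section BNCOrder.
Variables (n : nat) (I J : Type) (chi : 'I_n -> I + J).

Lemma s_seq_sorted : sorted (boundary_lt (Defs.is_left chi)) (s_seq chi).
Proof.
rewrite (sorted_pairwise (@boundary_lt_trans _ _)) pairwise_cat.
have srt (P : pred 'I_n) : pairwise (fun i j : 'I_n => (i < j)%N) [seq k <- enum 'I_n | P k].
  rewrite -(@sorted_pairwise _ (fun i j : 'I_n => (i < j)%N)); last first.
    by move=> a b d; apply: ltn_trans.
  apply: sorted_filter => [a b d|]; first exact: ltn_trans.
  by have := iota_ltn_sorted 0 n; rewrite -val_enum_ord sorted_map.
apply/and3P; split.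
- apply/allrelP => x z; rewrite mem_rev !mem_filter /boundary_lt.
  by case/andP=> -> _ /andP[/negbTE-> _].
- apply: sub_in_pairwise (filter_all _ _) (srt (Defs.is_left chi)) => x z.
  by rewrite /boundary_lt !unfold_in => -> ->.
have := srt (fun k => ~~ Defs.is_left chi k).
set s := [seq k <- _ | _] => /(@sub_in_pairwise _ (fun k => ~~ Defs.is_left chi k) _
  (fun x z => boundary_lt (Defs.is_left chi) z x)) H.
have : pairwise (fun x z => boundary_lt (Defs.is_left chi) z x) s.
  apply: H; last exact: filter_all.
  by move=> x z; rewrite /boundary_lt !unfold_in => /negbTE-> /negbTE->.
elim: (s) => //= a r IH /andP[/allP ar /IH pr]; rewrite rev_cons pairwise_rcons pr andbT.
by apply/allP => b; rewrite mem_rev; apply: ar.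
Qed.

Lemma boundary_lt_s_chi k l :
  boundary_lt (Defs.is_left chi) (s_chi chi k) (s_chi chi l) = (k < l)%N.
Proof.
have H (a b : 'I_n) : (a < b)%N ->
    boundary_lt (Defs.is_left chi) (s_chi chi a) (s_chi chi b).
  move=> ab; rewrite /s_chi (set_nth_default b a) ?size_s_seq //.
  by apply: (sorted_ltn_nth (@boundary_lt_trans _ _) _ s_seq_sorted) => //;
    rewrite inE size_s_seq.
apply/idP/idP => [kl|]; last exact: H.
case: (ltngtP k l) => // [lk|/val_inj E]; last by rewrite E boundary_lt_irr in kl.
by have := boundary_lt_trans kl (H _ _ lk); rewrite boundary_lt_irr.
Qed.

Lemma BNC_boundary :
  BNC chi =
  [set pi | partition pi [set: 'I_n] &&
            noncrossing_for (boundary_lt (Defs.is_left chi)) pi].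
Proof.
have sI := @s_chi_inj n I J chi.
have sT : s_chi chi @: [set: 'I_n] = [set: 'I_n].
  by apply/eqP; rewrite eqEcard subsetT /= card_imset.
have nsE (sg : {set {set 'I_n}}) :
    noncrossing_for (boundary_lt (Defs.is_left chi))
      [set s_chi chi @: V | V : {set 'I_n} in sg] =
    noncrossing sg.
  apply/noncrossing_forP/(@noncrossing_forP _ (fun a b : 'I_n => (a < b)%N)) => H.
    move=> V W a b c d Vs Ws aV bW cV dW ab bc cd.
    apply: (imset_inj sI).
    apply: (H _ _ (s_chi chi a) (s_chi chi b) (s_chi chi c) (s_chi chi d));
      by rewrite ?boundary_lt_s_chi ?imset_f.
  move=> _ _ _ _ _ _ /imsetP[V Vs ->] /imsetP[W Ws ->] /imsetP[a aV ->] /imsetP[b bW ->]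
    /imsetP[c0 cV ->] /imsetP[d dW ->]; rewrite !boundary_lt_s_chi => ab bc cd.
  by rewrite (H V W a b c0 d).
apply/setP => pi; rewrite inE; apply/imsetP/idP => [[sg]|].
  rewrite inE => /andP[sgp sgn] ->.
  by rewrite -[X in partition _ X]sT imset_partition // sgp nsE.
move=> /andP[pp pn].
have E : pi = [set s_chi chi @: V |
    V : {set 'I_n} in [set s_chi chi @^-1: V | V : {set 'I_n} in pi]].
  have VE (V : {set 'I_n}) : s_chi chi @: (s_chi chi @^-1: V) = V.
    apply/setP => x; apply/imsetP/idP => [[y]|xV]; first by rewrite inE => yV ->.
    have : x \in s_chi chi @: [set: 'I_n] by rewrite sT inE.
    by case/imsetP => y _ xy; exists y; rewrite // inE -xy.
  rewrite -imset_comp -[LHS]imset_id; apply: eq_imset => V /=; exact/esym/VE.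
exists [set s_chi chi @^-1: V | V : {set 'I_n} in pi] => //.
rewrite inE -nsE -E pn andbT -(imset_partition _ _ sI) sT -E //.
Qed.

End BNCOrder.

Lemma sum_BNC_fock (I J : Type) n (l : 'I_n -> I + J) (C : comNzRingType)
    (c : seq (I + J) -> C) :
  \sum_(pi in BNC l) \prod_(V in pi) c [seq l k | k <- enum V] =
  fock_moment (fun x => if x is inl _ then true else false) c (codom l).
Proof.
rewrite /codom -noncrossing_sum_fock; apply: eq_bigl => pi.
by rewrite BNC_boundary inE.
Qed.

(** * Positive semidefinite kernels *)

Section PositiveKernels.
Variable C : numClosedFieldType.

Section Def.
Variable T : Type.
Implicit Types (k h : T -> T -> C) (s : seq (C * T)).

Definition hform k s : C :=
  \sum_(p <- s) \sum_(q <- s) p.1^* * q.1 * k p.2 q.2.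

Definition psd k := forall s, 0 <= hform k s.

Lemma eq_psd k h : k =2 h -> psd k -> psd h.
Proof.
move=> E kp s; have := kp s; rewrite /hform.
by under eq_bigr => p _ do under eq_bigr => q _ do rewrite E.
Qed.

Lemma psd_diag k x : psd k -> 0 <= k x x.
Proof. by move/(_ [:: (1, x)]); rewrite /hform !big_seq1 /= conjC1 !mul1r. Qed.

(** Polarization: the form is real at [a x + y] for [a = 1] and [a = 'i]. *)
Lemma psd_herm k : psd k -> forall x y, k y x = (k x y)^*.
Proof.
move=> kp x y.
have realD (a : C) : (a^* * k x y + a * k y x) \is Num.real.
  have := kp [:: (1, y); (a, x)].
  rewrite /hform !big_cons !big_nil /= !addr0 conjC1 !mul1r.
  have ky := ger0_real (psd_diag y kp); have kx := ger0_real (psd_diag x kp).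
  have aa : a^* * a * k x x \is Num.real.
    by rewrite rpredM // mulrC -normCK ger0_real // exprn_ge0.
  move/ger0_real => H; rewrite mulr1 in H.
  have -> : a^* * k x y + a * k y x =
     k y y + a * k y x + (a^* * k x y + a^* * a * k x x) - k y y - a^* * a * k x x by ring.
  by rewrite !rpredB.
have H1 := realD 1; have Hi := realD 'i.
move: H1 Hi; rewrite conjC1 !mul1r conjCi => /CrealP; rewrite rmorphD /= => H1.
move/CrealP; rewrite rmorphD !rmorphM /= rmorphN /= conjCi opprK => Hi.
have {}Hi : (k x y)^* - (k y x)^* = k y x - k x y.
  apply: (mulfI (neq0Ci C)); rewrite !mulrBr.
  by move: Hi; rewrite !mulNr => ->; rewrite addrC.
have two : (2%:R : C) != 0 by rewrite pnatr_eq0.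
apply: (mulfI two); rewrite !mulr_natl !mulr2n.
have -> : k y x + k y x = (k x y + k y x) + (k y x - k x y) by ring.
by rewrite -H1 -Hi; ring.
Qed.

Lemma psd_add k h : psd k -> psd h -> psd (fun x y => k x y + h x y).
Proof.
move=> kp hp s; have := addr_ge0 (kp s) (hp s); rewrite /hform -big_split /=.
under eq_bigr => p _ do rewrite -big_split /=.
by under eq_bigr => p _ do under eq_bigr => q _ do rewrite -mulrDr.
Qed.

Lemma psd_rank1 (b : T -> C) : psd (fun x y => (b x)^* * b y).
Proof.
move=> s; rewrite /hform.
suff -> : \sum_(p <- s) \sum_(q <- s) p.1^* * q.1 * ((b p.2)^* * b q.2) =
   (\sum_(p <- s) p.1 * b p.2)^* * (\sum_(p <- s) p.1 * b p.2).
  by rewrite mulrC -normCK exprn_ge0.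
rewrite rmorph_sum /= mulr_suml; apply: eq_bigr => p _.
by rewrite mulr_sumr; apply: eq_bigr => q _; rewrite rmorphM /=; ring.
Qed.

Lemma psd_scale (b : T -> C) k : psd k -> psd (fun x y => (b x)^* * b y * k x y).
Proof.
move=> kp s; have := kp [seq (p.1 * b p.2, p.2) | p <- s].
rewrite /hform big_map; under eq_bigr => p _ do rewrite big_map.
congr (_ <= _); apply: eq_bigr => p _; apply: eq_bigr => q _ /=.
by rewrite rmorphM /=; ring.
Qed.

Lemma psd0 : psd (fun _ _ => 0).
Proof.
by move=> s; rewrite /hform; rewrite big1 // => p _; rewrite big1 // => q _; rewrite mulr0.
Qed.

(** The Schur complement at [x0] is the form on vectors corrected by the multiple
    of [x0] that minimizes it.  When [k x0 x0 = 0] the convention [0^-1 = 0]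
    makes the correction disappear. *)
Lemma psd_schur_complement k x0 : psd k ->
  psd (fun x y => k x y - k x x0 * k x0 y / k x0 x0).
Proof.
move=> kp s; set r := \sum_(q <- s) q.1 * k x0 q.2.
have [k0|k0] := eqVneq (k x0 x0) 0.
  by rewrite k0 (_ : hform _ s = hform k s) // /hform; apply: eq_bigr => p _;
    apply: eq_bigr => q _; rewrite invr0 mulr0 subr0.
have herm := psd_herm kp.
have := kp ((- r / k x0 x0, x0) :: s); congr (_ <= _).
rewrite /hform big_cons /= big_cons /=.
under [X in _ + X]eq_bigr => p _ do rewrite big_cons /=.
rewrite big_split /=.
have E1 : \sum_(q <- s) (- r / k x0 x0)^* * q.1 * k x0 q.2 = (- r / k x0 x0)^* * r.
  by rewrite /r mulr_sumr; apply: eq_bigr => q _; rewrite mulrA.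
have E2 : \sum_(p <- s) p.1^* * (- r / k x0 x0) * k p.2 x0 = (- r / k x0 x0) * r^*.
  rewrite /r [in RHS]rmorph_sum mulr_sumr; apply: eq_bigr => p _.
  by rewrite (herm x0 p.2) rmorphM /=; ring.
have E3 : \sum_(p <- s) \sum_(q <- s)
     p.1^* * q.1 * (k p.2 q.2 - k p.2 x0 * k x0 q.2 / k x0 x0) =
   hform k s - r^* * r / k x0 x0.
  rewrite /r rmorph_sum /= mulr_suml mulr_suml -sumrB; apply: eq_bigr => p _.
  rewrite mulr_sumr mulr_suml -sumrB; apply: eq_bigr => q _.
  by rewrite rmorphM /= (herm x0 p.2); ring.
rewrite E1 E2 E3 -/(hform k s).
have k0r : (k x0 x0)^* = k x0 x0 by rewrite -herm.
rewrite rmorphM rmorphN fmorphV /= k0r.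
by field.
Qed.

Lemma psd_null k x0 y : psd k -> k x0 x0 = 0 -> k x0 y = 0.
Proof.
move=> kp k0; apply/eqP/negPn/negP => kn.
have herm := psd_herm kp.
(* This multiple of x0 brings the value of the form at a x0 + y to -1. *)
pose a := - (k y y + 1) / (2%:R * `|k x0 y| ^+ 2) * (k y x0)^*.
have n0 : `|k x0 y| != 0 by rewrite normr_eq0.
have kyr : (k y y)^* = k y y by rewrite -herm.
have := kp [:: (a, x0); (1, y)].
rewrite /hform !big_cons !big_nil /= k0 !addr0 mulr0 conjC1 !mul1r add0r mulr1.
have nE : `|k x0 y| ^+ 2 = k x0 y * (k x0 y)^* by rewrite normCK.
have c0 : (k x0 y)^* != 0 by rewrite conjC_eq0.
have -> : a^* * k x0 y + (a * k y x0 + k y y) = -1.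
  rewrite /a nE (herm x0 y) conjCK !rmorphM fmorphV rmorphN rmorphD rmorph1 !rmorphM /=.
  rewrite conjCK rmorph_nat kyr; field.
  by rewrite kn c0.
by rewrite oppr_ge0 ler10.
Qed.

End Def.

(** The kernel of inner products of vectors [e u], each a linear combination of
    points. *)
Lemma psd_pull (S T : Type) (k : T -> T -> C) (e : S -> seq (C * T)) :
  psd k ->
  psd (fun u v => \sum_(p <- e u) \sum_(q <- e v) p.1^* * q.1 * k p.2 q.2).
Proof.
move=> kp s.
have := kp (flatten [seq [seq (p.1 * q.1, q.2) | q <- e p.2] | p <- s]).
rewrite /hform big_flatten big_map; congr (_ <= _); apply: eq_bigr => p _.
rewrite big_map.
under eq_bigr => q _.
  rewrite big_flatten big_map; under eq_bigr => p' _ do rewrite big_map.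
  over.
rewrite exchange_big /=; apply: eq_bigr => p' _; rewrite mulr_sumr.
apply: eq_bigr => q _; rewrite mulr_sumr; apply: eq_bigr => q' _ /=.
by rewrite rmorphM /=; ring.
Qed.

Lemma psd_comp (S T : Type) (k : T -> T -> C) (g : S -> T) :
  psd k -> psd (fun u v => k (g u) (g v)).
Proof.
move=> kp; apply: eq_psd (psd_pull (fun u => [:: (1, g u)]) kp) => u v /=.
by rewrite !big_seq1 /= conjC1 !mul1r.
Qed.

(** Cholesky decomposition on a finite set: the Schur complement at a point
    vanishes on the row and the column of that point, so induction applies to
    the remaining points. *)
Lemma psd_gram (T : eqType) (k : T -> T -> C) (s : seq T) : psd k ->
  exists bs : seq (T -> C), forall x y, x \in s -> y \in s ->
    k x y = \sum_(b <- bs) (b x)^* * b y.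
Proof.
elim: s k => [|x0 s IH] k kp; first by exists [::].
pose k' x y := k x y - k x x0 * k x0 y / k x0 x0.
have k'p : psd k' by exact: psd_schur_complement.
have herm := psd_herm kp; have herm' := psd_herm k'p.
have k00 : (k x0 x0)^* = k x0 x0 by rewrite -herm.
have k'0 y : k' x0 y = 0.
  rewrite /k'; have [k0|k0] := eqVneq (k x0 x0) 0; last first.
    by rewrite mulrAC divff // mul1r subrr.
  by rewrite (psd_null y kp k0) !mulr0 mul0r subr0.
have [bs bsE] := IH k' k'p.
pose b0 y := k x0 y / sqrtC (k x0 x0).
exists (b0 :: [seq (fun y => (y != x0)%:R * b y) | b <- bs]) => x y xs ys.
rewrite big_cons big_map.
have -> : (b0 x)^* * b0 y = k x x0 * k x0 y / k x0 x0.
  rewrite /b0 rmorphM fmorphV /= -herm.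
  have sq : (sqrtC (k x0 x0))^* = sqrtC (k x0 x0).
    by apply/CrealP/ger0_real; rewrite sqrtC_ge0 psd_diag.
  by rewrite sq mulrACA -invfM -expr2 sqrtCK.
apply/eqP; rewrite -subr_eq0 opprD addrA subr_eq0 -/(k' x y); apply/eqP.
under eq_bigr => b _ do rewrite rmorphM /= rmorph_nat.
have [->|xx0] := eqVneq x x0.
  by rewrite k'0 big1 // => b _; rewrite !mul0r.
have [->|yx0] := eqVneq y x0.
  by rewrite herm' k'0 conjC0 big1 // => b _; rewrite mul0r mulr0.
rewrite bsE; last 2 first.
- by move: xs; rewrite in_cons (negbTE xx0).
- by move: ys; rewrite in_cons (negbTE yx0).
by apply: eq_bigr => b _; rewrite !mul1r.
Qed.

(** Schur's product theorem: after a Cholesky decomposition of one factor, the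
    product is a sum of rescalings of the other. *)
Lemma psd_mul (T : eqType) (k h : T -> T -> C) :
  psd k -> psd h -> psd (fun x y => k x y * h x y).
Proof.
move=> kp hp s; have [bs bsE] := psd_gram [seq p.2 | p <- s] kp.
have -> : hform (fun x y => k x y * h x y) s =
    \sum_(b <- bs) hform (fun x y => (b x)^* * b y * h x y) s.
  rewrite /hform [RHS]exchange_big /= [LHS]big_seq [RHS]big_seq; apply: eq_bigr => p ps.
  rewrite [RHS]exchange_big /= [LHS]big_seq [RHS]big_seq; apply: eq_bigr => q qs.
  by rewrite bsE ?map_f // -mulr_sumr mulr_suml.
by apply: sumr_ge0 => b _; apply: psd_scale.
Qed.

Section FockPositive.
Variables (K : eqType) (left : pred K) (c : seq K -> C).
Hypothesis c_psd : psd (fun u v => c (rev u ++ v)).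

(** The Gram kernel cut off at [m] tensor factors, written as a recursion that only
    uses sums, products and substitutions in kernels. *)
Fixpoint bounded_gram (m : nat) (P O : seq (seq K)) {struct m} : C :=
  ((nilp P)%:R : C)^* * (nilp O)%:R
  + if m is m'.+1 then
      ((~~ nilp P)%:R : C)^* * (~~ nilp O)%:R *
      (c (rev (head [::] P) ++ head [::] O) * bounded_gram m' (behead P) (behead O))
    else 0.

Lemma fock_gram_psd : psd (fock_gram c).
Proof.
pose G := bounded_gram.
have Gp m : psd (G m).
  elim: m => [|m IH] /=; apply: psd_add; try exact: psd_rank1; first exact: psd0.
  apply: psd_scale; apply: psd_mul; first exact: (psd_comp (head [::]) c_psd).
  exact: (psd_comp behead IH).
have GE m P O : (size P <= m)%N -> G m P O = fock_gram c P O.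
  elim: m P O => [|m IH] [|p P] [|o O] //=;
    rewrite ?conjC0 ?conjC1 ?mul0r ?mulr0 ?addr0 ?add0r ?mul1r.
  1-5: by rewrite /fock_gram /= ?big_nil ?mul0r.
  rewrite ltnS => Pm; rewrite IH // /fock_gram /= eqSS.
  by case: eqP => _; rewrite ?mulr0 // big_cons.
move=> s; have := Gp (\max_(p <- s) size p.2) s; congr (_ <= _).
rewrite /hform big_seq [RHS]big_seq; apply: eq_bigr => p ps; apply: eq_bigr => q _.
by rewrite GE //; exact: (leq_bigmax_seq (F := fun p : C * seq (seq K) => size p.2) p ps isT).
Qed.

(** A positive semidefinite kernel is hermitian, so reversing words in the
    coefficients conjugates them. *)
Lemma fock_vect_conj w O :
  run_vect left (c \o rev) w O = [seq (p.1^*, p.2) | p <- run_vect left c w O].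
Proof.
have cr u : c (rev u) = (c u)^*.
  by have := psd_herm c_psd [::] u; rewrite /= cats0.
have step x O' : step_vect left (c \o rev) x O' =
    [seq (p.1^*, p.2) | p <- step_vect left c x O'].
  have lE P : left_vect (c \o rev) x P = [seq (p.1^*, p.2) | p <- left_vect c x P].
    have cx : (c [:: x])^* = c [:: x] by rewrite -cr.
    by rewrite /left_vect; case: P => [|p P] /=; rewrite !cr conjC1 !cx.
  by rewrite /step_vect; case: ifP => _; rewrite lE // -!map_comp.
elim: w O => [|x w IH] O /=; first by rewrite conjC1.
rewrite step map_flatten -!map_comp; congr flatten; apply: eq_map => p /=.
rewrite IH /scale_vect -!map_comp; apply: eq_map => q /=.
by rewrite rmorphM.
Qed.

Lemma fock_moment_psd : psd (fun u v => fock_moment left c (rev u ++ v)).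
Proof.
apply: eq_psd (psd_pull (fun u => run_vect left c (rev u) [::]) fock_gram_psd) => u v.
by rewrite fock_moment_gram fock_vect_conj big_map.
Qed.

End FockPositive.
End PositiveKernels.

(** * Functionals on non-commutative polynomials *)

Lemma prod_codom (A : pzRingType) (L : Type) n (l : 'I_n -> L) (F : L -> A) :
  \prod_(k < n) F (l k) = \prod_(x <- codom l) F x.
Proof. by rewrite /codom /image_mem big_map enumT unlock. Qed.

Lemma codom_tnth (L : Type) (w : seq L) : codom (tnth (in_tuple w)) = w.
Proof. by rewrite /codom /image_mem map_tnth_enum. Qed.

Section WordFunctional.
Variables (S : comNzRingType) (K : choiceType).
Implicit Types (m : seq K -> S) (w : seq K) (P : ncpoly S K).

Definition ncword w : ncpoly S K := << FMonom w >>.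

Lemma ncword_nil : ncword [::] = 1.
Proof. by rewrite /ncword -fmoneE. Qed.

Lemma ncwordM u v : ncword u * ncword v = ncword (u ++ v).
Proof.
rewrite /ncword [LHS]malgM_def fgmulUU mulr1.
by rewrite (_ : mmul _ _ = FMonom (u ++ v)) //; apply: fmmulE.
Qed.

Lemma ncword_prod w : \prod_(k <- w) ncX S k = ncword w.
Proof.
elim: w => [|k w IH]; first by rewrite big_nil ncword_nil.
by rewrite big_cons IH /ncX fmuE -/(ncword [:: k]) ncwordM.
Qed.

Lemma ncword_sum P : P = \sum_(w <- msupp P) P@_w *: ncword w.
Proof.
rewrite {1}[P]monalgE; apply: eq_bigr => w _.
apply/malgP => k; rewrite mcoeffZ !mcoeffU mulr_natr.
by case: w => w; case: eqP.
Qed.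

Lemma linear_ncword (phi : {scalar ncpoly S K}) P :
  phi P = \sum_(w <- msupp P) P@_w * phi (ncword w).
Proof.
by rewrite {1}[P]ncword_sum linear_sum; apply: eq_bigr => w _; rewrite linearZ.
Qed.

Definition word_functional m (P : ncpoly S K) : S :=
  mmap idfun (fun w : {fmonom K} => m w) P.

Lemma word_functional_is_scalar m : scalar (word_functional m).
Proof.
move=> a P Q; rewrite /word_functional mmapD; congr (_ + _).
pose h (w : {fmonom K}) : S := m w.
suff H (T : {malg S[{fmonom K}]}) : mmap idfun h (a *: T) = a * mmap idfun h T by exact: H.
rewrite (mmapEw (msuppZ_le _ _)) mmapE mulr_sumr.
by apply: eq_bigr => w _; rewrite mcoeffZ mulrA.
Qed.

HB.instance Definition _ m :=
  GRing.isLinear.Build S (ncpoly S K) S _ (word_functional m)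
    (word_functional_is_scalar m).

Lemma word_functionalE m w : word_functional m (ncword w) = m w.
Proof. by rewrite /word_functional mmapU mul1r. Qed.

Lemma nceval_ncword (A : algType S) (z : K -> A) w :
  nceval z (ncword w) = \prod_(k <- w) z k.
Proof. by rewrite /nceval mmapU /= scale1r mul1r. Qed.

Lemma nceval_sum (A : algType S) (z : K -> A) P :
  nceval z P = \sum_(w <- msupp P) P@_w *: \prod_(k <- w) z k.
Proof.
by rewrite /nceval mmapE; apply: eq_bigr => w _; rewrite /= mulr_algl.
Qed.

End WordFunctional.

(** * Cumulants along words *)

Section Words.
Variable L : Type.

(** Every family indexed by ['I_n] is the family of letters of a word; this is how
    statements about families are transported to words. *)
Lemma word_ind (Q : forall n, ('I_n -> L) -> Prop) :
  (forall w, Q (size w) (tnth (in_tuple w))) -> forall n l, Q n l.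
Proof.
move=> Qw n l; have := Qw (codom l).
have e : size (codom l) = n by rewrite size_codom card_ord.
have E k : tnth (in_tuple (codom l)) k = l (cast_ord e k).
  rewrite (tnth_nth (l (cast_ord e k))) /=.
  rewrite (nth_codom _ l (cast_ord (esym (card_ord n)) (cast_ord e k))).
  by rewrite enum_val_ord cast_ordKV.
move: (tnth _) E; move: (size _) e => m e; subst m => l' E.
by rewrite (_ : l' = l) //; apply/funext => k; rewrite E cast_ord_id.
Qed.

Lemma codom_enum_val n (l : 'I_n -> L) (V : {set 'I_n}) :
  codom (fun k : 'I_#|V| => l (enum_val k)) = [seq l k | k <- enum V].
Proof.
rewrite /codom /image_mem (map_comp l enum_val); congr map.
have [V0|/set0Pn[x xV]] := eqVneq V set0.
  by rewrite V0 enum_set0; apply/nilP; rewrite /nilp size_map size_enum_ord cards0.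
apply: (@eq_from_nth _ x); first by rewrite size_map size_enum_ord cardE.
move=> i; rewrite size_map size_enum_ord => iV.
rewrite (nth_map (Ordinal iV)) ?size_enum_ord // (enum_val_nth x).
by rewrite nth_enum_ord.
Qed.

End Words.

Section WordCumulants.
Variables (R : realType) (I J : Type).
Local Notation C := R[i].

Section Labels.
Variables (L : Type) (chi : L -> I + J).
Implicit Types (w : seq L) (kap : seq L -> C).

(** The right-hand side of the moment-cumulant formula, for arbitrary numbers
    [kap] in place of the cumulants.  The letters are labels mapped to [I + J]
    by [chi]; besides [I + J] itself, pairs of a colour and an element of
    [I + J] are used, to follow which of two families a factor comes from. *)
Definition bnc_sum kap w : C :=
  \sum_(pi in BNC (fun k => chi (tnth (in_tuple w) k))) \prod_(V in pi)
     kap [seq tnth (in_tuple w) k | k <- enum V].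

Lemma bnc_sum_codom kap n (l : 'I_n -> L) :
  bnc_sum kap (codom l) =
  \sum_(pi in BNC (fun k => chi (l k))) \prod_(V in pi) kap [seq l k | k <- enum V].
Proof.
by move: n l; apply: word_ind => w; rewrite codom_tnth.
Qed.

(** The part of [bnc_sum] that only involves shorter words. *)
Definition bnc_low kap w : C :=
  \sum_(pi in BNC (fun k => chi (tnth (in_tuple w) k)) |
          pi != [set [set: 'I_(size w)]]) \prod_(V in pi)
     kap [seq tnth (in_tuple w) k | k <- enum V].

Lemma bnc_sum_low kap w : (0 < size w)%N ->
  bnc_sum kap w = kap w + bnc_low kap w.
Proof.
move=> w0; rewrite /bnc_sum (bigD1 [set [set: 'I_(size w)]]) ?full_BNC //=.
by rewrite big_set1 enum_setT -enumT map_tnth_enum.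
Qed.

Lemma eq_bnc_low kap kap' w :
  (forall v, (0 < size v < size w)%N -> kap v = kap' v) ->
  bnc_low kap w = bnc_low kap' w.
Proof.
move=> E; apply: eq_bigr => pi /andP[piB piT]; apply: eq_bigr => V Vpi.
by apply: E; rewrite size_map -cardE (BNC_block piB piT Vpi).
Qed.

Lemma eq_bnc_sum kap kap' w : (0 < size w)%N ->
  (forall v, (0 < size v)%N -> kap v = kap' v) -> bnc_sum kap w = bnc_sum kap' w.
Proof.
move=> w0 E; rewrite !bnc_sum_low // E //; congr (_ + _).
by apply: eq_bnc_low => v /andP[v0 _]; apply: E.
Qed.

Lemma bnc_sum_inj kap kap' :
  (forall w, (0 < size w)%N -> bnc_sum kap w = bnc_sum kap' w) ->
  forall w, (0 < size w)%N -> kap w = kap' w.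
Proof.
move=> E w; have [m wm] := ubnP (size w); elim: m => // m IH in w wm * => w0.
have := E w w0; rewrite !bnc_sum_low //.
rewrite (@eq_bnc_low kap kap') => [/addIr//|v /andP[v0 vw]].
by apply: IH v0; apply: leq_trans vw _.
Qed.

Variables (A : algType C) (phi : {scalar A}) (z : L -> A).

Definition word_cumulant w : C :=
  cumulant phi (fun k => chi (tnth (in_tuple w) k)) (fun k => z (tnth (in_tuple w) k)).

Lemma word_cumulant_codom n (l : 'I_n -> L) :
  word_cumulant (codom l) = cumulant phi (fun k => chi (l k)) (fun k => z (l k)).
Proof. by move: n l; apply: word_ind => w; rewrite codom_tnth. Qed.

Lemma word_moment w : (0 < size w)%N ->
  phi (\prod_(x <- w) z x) = bnc_sum word_cumulant w.
Proof.
move=> w0; rewrite -[in LHS](codom_tnth w) -prod_codom.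
rewrite (moment_cumulant phi (fun k => chi (tnth (in_tuple w) k))) //.
apply: eq_bigr => pi _; apply: eq_bigr => V _.
by rewrite -codom_enum_val word_cumulant_codom.
Qed.

(** Cumulants are identified by exhibiting numbers that satisfy the
    moment-cumulant formula, without unfolding their recursive definition. *)
Lemma word_cumulant_unique kap :
  (forall w, (0 < size w)%N -> phi (\prod_(x <- w) z x) = bnc_sum kap w) ->
  forall w, (0 < size w)%N -> word_cumulant w = kap w.
Proof. by move=> E; apply: bnc_sum_inj => w w0; rewrite -word_moment // E. Qed.

End Labels.

Lemma bnc_sum_relabel (L L' : Type) (f : L' -> L) (chi : L -> I + J) kap w :
  bnc_sum chi kap (map f w) = bnc_sum (fun x => chi (f x)) (fun v => kap (map f v)) w.
Proof.
rewrite -[in LHS](codom_tnth w) /codom /image_mem -map_comp.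
rewrite (@bnc_sum_codom _ chi kap _ (fun k => f (tnth (in_tuple w) k))).
by apply: eq_bigr => pi _; apply: eq_bigr => V _; rewrite -map_comp.
Qed.

Lemma word_cumulant_relabel (L L' : Type) (f : L' -> L) (chi : L -> I + J)
    (A : algType C) (phi : {scalar A}) (z : L -> A) w :
  word_cumulant chi phi z (map f w) =
  word_cumulant (fun x => chi (f x)) phi (fun x => z (f x)) w.
Proof.
rewrite -[in LHS](codom_tnth w) /codom /image_mem -map_comp.
exact: (word_cumulant_codom chi phi z (fun k => f (tnth (in_tuple w) k))).
Qed.

End WordCumulants.

(** * Bi-free convolution adds cumulants *)

Section Colours.
Variables (R : realType) (I J : Type) (L : eqType) (chi : L -> I + J).
Local Notation C := R[i].
Variable kap : bool -> seq L -> C.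

(** Cumulants of the union of two bi-free families with cumulants [kap false] and
    [kap true]: mixed ones vanish. *)
Definition mono_colour (v : seq (bool * L)) : C :=
  if v is (b, _) :: _ then
    if all (fun p => p.1 == b) v then kap b (map snd v) else 0
  else 0.

(** Only colourings that are constant on the blocks of [pi] contribute, and they
    correspond to choosing a colour for each block, which expands
    the product of the [kap false + kap true]. *)
Lemma sum_colourings w : (0 < size w)%N ->
  \sum_(eps : {ffun 'I_(size w) -> bool})
     bnc_sum (fun p => chi p.2) mono_colour
       (codom (fun k => (eps k, tnth (in_tuple w) k))) =
  bnc_sum chi (fun v => kap false v + kap true v) w.
Proof.
move=> w0; set l := tnth (in_tuple w).
under eq_bigr => eps _ do rewrite bnc_sum_codom /=.
rewrite exchange_big; apply: eq_bigr => pi piB.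
have part : partition pi [set: 'I_(size w)].
  by move: piB; rewrite BNC_boundary inE => /andP[].
case/and3P: (part) => /eqP cov /trivIsetP tri s0.
have triE V W x : V \in pi -> W \in pi -> x \in V -> x \in W -> V = W.
  move=> Vp Wp xV xW; apply/eqP/negPn/negP => VW.
  have /(_ V W Vp Wp VW) := tri; rewrite -setI_eq0 => /eqP/setP/(_ x).
  by rewrite !inE xV xW.
have inpb k : pblock pi k \in pi by rewrite pblock_mem // cov inE.
have inpb' k : k \in pblock pi k by rewrite mem_pblock cov inE.
rewrite -/l.
under [RHS]eq_bigr => V _.
  rewrite (_ : _ + _ = \sum_(b : bool) kap b [seq l k | k <- enum V]); last first.
    by rewrite big_bool /= addrC.
  over.
rewrite (big_distr_big false) /=.
pose blockwise (eps : {ffun 'I_(size w) -> bool}) :=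
  [forall k, forall k', (pblock pi k == pblock pi k') ==> (eps k == eps k')].
rewrite (bigID blockwise) /= [X in _ + X]big1 ?addr0; last first.
  move=> eps /forallPn[k /forallPn[k']]; rewrite negb_imply => /andP[/eqP kk' ee'].
  rewrite (bigD1 (pblock pi k)) //=.
  rewrite (_ : mono_colour _ = 0) ?mul0r // /mono_colour.
  case E : [seq _ | _ <- _] => [//|[b x] r]; rewrite -E; case: ifP => // /allP H.
  have Hb j : j \in pblock pi k -> eps j = b.
    by move=> jk; apply/eqP/(H (eps j, l j)); apply: map_f; rewrite mem_enum.
  by move: ee'; rewrite !Hb ?eqxx // kk'.
pose up (g : {ffun {set 'I_(size w)} -> bool}) : {ffun 'I_(size w) -> bool} :=
  [ffun k => g (pblock pi k)].
pose down (eps : {ffun 'I_(size w) -> bool}) : {ffun {set 'I_(size w)} -> bool} :=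
  [ffun V : {set 'I_(size w)} => (V \in pi) && [exists k in V, eps k]].
rewrite (reindex_onto up down) /=; last first.
  move=> eps /forallP bw; apply/ffunP => k; rewrite !ffunE inpb /=.
  apply/exists_inP/idP => [[k' k'k ek']|ek]; last by exists k.
  have /forallP/(_ k')/implyP := bw k; rewrite (triE (pblock pi k) (pblock pi k') k') //.
  by rewrite eqxx => /(_ isT)/eqP->.
apply: eq_big => [g|g /andP[_ /eqP gE]]; last first.
  apply: eq_bigr => V Vp; rewrite /mono_colour.
  have Vb k : k \in V -> up g k = g V.
    by move=> kV; rewrite ffunE (triE V (pblock pi k) k).
  case E : [seq _ | _ <- _] => [|[b x] r].
    move: s0; rewrite -(_ : V = set0) ?Vp //.
    by apply/eqP; rewrite -cards_eq0 cardE -(size_map (fun k => (up g k, l k))) E.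
  have allb : all (fun p => p.1 == g V) [seq (up g k, l k) | k <- enum V].
    by rewrite all_map; apply/allP => k; rewrite mem_enum => kV /=; rewrite Vb.
  have bE : b = g V by move: allb; rewrite E /= => /andP[/eqP].
  by rewrite -E bE allb -map_comp.
apply/andP/pffun_onP => [[_ /eqP gE]|[gs _]].
  split; last by move=> b _.
  by apply/subsetP => V; rewrite inE -gE ffunE; apply: contraR => /negbTE->.
split.
  apply/forallP => k; apply/forallP => k'; apply/implyP => /eqP E.
  by rewrite !ffunE E.
apply/eqP/ffunP => V; rewrite ffunE.
have [Vp|Vp] := boolP (V \in pi); last first.
  by move: (contra (subsetP gs V) Vp); rewrite inE negbK => /eqP->.
have [k kV] : exists k, k \in V by apply/set0Pn; apply: contraNneq s0 => <-.
have Vb j : j \in V -> up g j = g V.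
  by move=> jV; rewrite ffunE (triE V (pblock pi j) j).
apply/exists_inP/idP => [[j jV]|gV]; first by rewrite Vb.
by exists k => //; rewrite Vb.
Qed.

End Colours.

Lemma map_snd_pair (T U : Type) (b : T) (s : seq U) :
  [seq p.2 | p <- [seq (b, y) | y <- s]] = s.
Proof. by elim: s => //= y s ->. Qed.

Section Functionals.
Variables (R : realType) (I J : choiceType).
Local Notation C := R[i].
Local Notation K := (I + J)%type.
Implicit Types (mu nu : ncfunctional R I J) (w : seq K) (kap : seq K -> C).

Definition ncmoment mu w : C := mu (ncword C w).
Definition nccumulant mu w : C := word_cumulant (fun x : K => x) mu (@ncX C _) w.
Local Notation bsum := (bnc_sum (fun x : K => x)).

Lemma ncmoment_nil mu : ncmoment mu [::] = mu 1.
Proof. by rewrite /ncmoment ncword_nil. Qed.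

Lemma ncmoment_cumulant mu w : (0 < size w)%N ->
  ncmoment mu w = bsum (nccumulant mu) w.
Proof. by move=> w0; rewrite /ncmoment -ncword_prod (word_moment (fun x : K => x)). Qed.

Lemma nccumulant_unique mu kap :
  (forall w, (0 < size w)%N -> ncmoment mu w = bsum kap w) ->
  forall w, (0 < size w)%N -> nccumulant mu w = kap w.
Proof.
by move=> E; apply: word_cumulant_unique => w w0; rewrite ncword_prod; apply: E.
Qed.

Lemma eq_ncfunctional mu nu :
  (forall w, ncmoment mu w = ncmoment nu w) -> forall P, mu P = nu P.
Proof.
move=> E P; rewrite (linear_ncword mu) (linear_ncword nu).
by apply: eq_bigr => w _; rewrite -/(ncmoment _ _) E.
Qed.

Lemma eq_ncfunctional_cumulant mu nu : mu 1 = nu 1 ->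
  (forall w, (0 < size w)%N -> nccumulant mu w = nccumulant nu w) ->
  forall P, mu P = nu P.
Proof.
move=> E1 E; apply: eq_ncfunctional => -[|x w]; first by rewrite !ncmoment_nil.
by rewrite !ncmoment_cumulant //; apply: eq_bnc_sum.
Qed.

(** The value at the empty word is prescribed separately, because the moment-cumulant
    formula is about words of positive length. *)
Definition unital_moment (L : Type) (m : seq L -> C) (w : seq L) : C :=
  if w is [::] then 1 else m w.

Definition cumulant_functional kap : ncfunctional R I J :=
  word_functional (unital_moment (bsum kap)).

Lemma cumulant_functional1 kap : cumulant_functional kap 1 = 1.
Proof. by rewrite -ncmoment_nil; apply: word_functionalE. Qed.

Lemma cumulant_functional_moment kap w : (0 < size w)%N ->
  ncmoment (cumulant_functional kap) w = bsum kap w.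
Proof. by case: w => // x w _; apply: word_functionalE. Qed.

Lemma cumulant_functionalE kap w : (0 < size w)%N ->
  nccumulant (cumulant_functional kap) w = kap w.
Proof.
by move: w; apply: nccumulant_unique => w w0; apply: cumulant_functional_moment.
Qed.

Lemma word_functional_distribution (A : algType C) (phi : {scalar A}) (z : K -> A) mu :
  has_distribution phi z mu <-> forall w, ncmoment mu w = phi (\prod_(k <- w) z k).
Proof.
split=> [E w|E P]; first by rewrite /ncmoment E nceval_ncword.
rewrite (linear_ncword mu) nceval_sum linear_sum; apply: eq_bigr => w _.
by rewrite linearZ -/(ncmoment _ _) E.
Qed.

Lemma sum_prod_colour (A : algType C) (phi : {scalar A}) (z : bool -> K -> A) w :
  phi (\prod_(k <- w) (z false k + z true k)) =
  \sum_(eps : {ffun 'I_(size w) -> bool})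
     phi (\prod_(p <- codom (fun k => (eps k, tnth (in_tuple w) k))) z p.1 p.2).
Proof.
rewrite -[in LHS](codom_tnth w) -(prod_codom _ (fun k => z false k + z true k)).
under eq_bigr => k _.
  rewrite (_ : _ + _ = \sum_(b : bool) z b (tnth (in_tuple w) k)); last first.
    by rewrite big_bool /= addrC.
  over.
rewrite bigA_distr_bigA linear_sum; apply: eq_bigr => eps _; congr (phi _).
by rewrite -(prod_codom _ (fun p : bool * K => z p.1 p.2)).
Qed.

(** The moments of [z1 + z2] expand over colourings of the letters, and bi-freeness
    says that the cumulants of a coloured word are given by [mono_colour]. *)
Lemma bifree_conv_cumulant mu1 mu2 mu : bifree_conv mu1 mu2 mu ->
  forall w, (0 < size w)%N ->
  nccumulant mu w = nccumulant mu1 w + nccumulant mu2 w.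
Proof.
case=> A [phi [z1 [z2 [phi1 free d1 d2 d]]]].
move/word_functional_distribution: d1 => d1.
move/word_functional_distribution: d2 => d2.
move/word_functional_distribution: d => d.
pose z (b : bool) := if b then z2 else z1.
pose kap (b : bool) w := word_cumulant (fun x : K => x) phi (z b) w.
have k1 w : (0 < size w)%N -> nccumulant mu1 w = kap false w.
  by move: w; apply: nccumulant_unique => w w0; rewrite d1 (word_moment (fun x => x)).
have k2 w : (0 < size w)%N -> nccumulant mu2 w = kap true w.
  by move: w; apply: nccumulant_unique => w w0; rewrite d2 (word_moment (fun x => x)).
move=> w w0; rewrite k1 // k2 //; move: w w0.
apply: (@nccumulant_unique _ (fun w => kap false w + kap true w)) => w w0.
rewrite d (sum_prod_colour phi z) -sum_colourings //; apply: eq_bigr => eps _.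
have s0 : (0 < size (codom (fun k => (eps k, tnth (in_tuple w) k))))%N.
  by rewrite size_codom card_ord.
rewrite (word_moment (fun p : bool * K => p.2) phi (fun p => z p.1 p.2)) //.
apply: eq_bnc_sum => // v v0; rewrite /mono_colour.
case: v v0 => [//|[b x] v] _; case: ifP => [/allP vb|vb].
  have -> : (b, x) :: v = [seq (b, y) | y <- map snd ((b, x) :: v)].
    rewrite -map_comp -[LHS]map_id; apply/eq_in_map => -[b' y] /vb /= /eqP->.
    by [].
  by rewrite word_cumulant_relabel map_snd_pair.
set v' := (b, x) :: v; have sz : size v' = (size v).+1 by [].
have/allPn[p pv pb] := negbT vb.
pose t := tnth (in_tuple v').
rewrite /word_cumulant.
rewrite (_ : (fun k => z _ _) =
   fun k : 'I_(size v') => if (t k).1 then z2 (t k).2 else z1 (t k).2); last first.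
  by apply/funext => k; rewrite /z /t; case: ifP.
apply: (free _ (fun k => (t k).2) (fun k => (t k).1)).
  by rewrite sz ltnS; case: (v) pv pb => //=; rewrite inE => /eqP->; rewrite eqxx.
have iv : (index p v' < size v')%N by rewrite index_mem.
exists (Ordinal iv), ord0.
by rewrite /t !(tnth_nth p) /= -/v' nth_index.
Qed.

(** The bi-free pair is realized in the polynomials on two coloured copies of the
    letters, with the functional whose cumulants are given by [mono_colour]. *)
Lemma bifree_conv_of_cumulant mu1 mu2 mu : mu1 1 = 1 -> mu2 1 = 1 -> mu 1 = 1 ->
  (forall w, (0 < size w)%N ->
     nccumulant mu w = nccumulant mu1 w + nccumulant mu2 w) ->
  bifree_conv mu1 mu2 mu.
Proof.
move=> u1 u2 u E; pose kap (b : bool) := if b then nccumulant mu2 else nccumulant mu1.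
pose chi (p : bool * K) := p.2.
pose m := unital_moment (bnc_sum chi (mono_colour kap)).
pose phi : {scalar ncpoly C (bool * K)%type} := word_functional m.
pose z (b : bool) (k : K) := ncX C (b, k).
have phiE v : phi (\prod_(p <- v) z p.1 p.2) = m v.
  rewrite (eq_bigr (fun p => ncX C p)) => [|[b k] _ //].
  by rewrite ncword_prod; apply: word_functionalE.
have mE v : (0 < size v)%N -> m v = bnc_sum chi (mono_colour kap) v by case: v.
have phiC v : (0 < size v)%N ->
    word_cumulant chi phi (fun p => z p.1 p.2) v = mono_colour kap v.
  by move: v; apply: word_cumulant_unique => v v0; rewrite phiE mE.
have phiz b w : phi (\prod_(k <- w) z b k) = ncmoment (if b then mu2 else mu1) w.
  have := phiE [seq (b, k) | k <- w]; rewrite big_map => ->.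
  case: w => [|x w]; first by rewrite ncmoment_nil; case: b.
  rewrite ncmoment_cumulant // mE // /chi bnc_sum_relabel.
  apply: eq_bnc_sum => // -[//|y v] _ /=.
  rewrite eqxx all_map (eq_all (a2 := xpredT)) ?all_predT /=; last first.
    by move=> k /=; rewrite eqxx.
  by rewrite map_snd_pair /kap; case: (b).
exists (ncpoly C (bool * K)%type), phi, (z false), (z true); split.
- by have := phiE [::]; rewrite big_nil.
- move=> n l eps n2 [k1 [k2 k12]].
  have n0 : (0 < n)%N by exact: leq_trans n2.
  have := word_cumulant_codom chi phi (fun p => z p.1 p.2) (fun k => (eps k, l k)).
  rewrite (_ : (fun k => z _ _) =
    fun k => if eps k then z true (l k) else z false (l k)); last first.
    by apply/funext => k /=; case: ifP.
  move=> <-; rewrite phiC ?size_codom ?card_ord // /mono_colour.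
  case v : (codom _) => [//|[b x] r]; rewrite -v; case: ifP => // /allP H.
  have Hb k : eps k = b by apply/eqP/(H (eps k, l k))/codom_f.
  by rewrite !Hb eqxx in k12.
- by apply/word_functional_distribution => w; rewrite phiz.
- by apply/word_functional_distribution => w; rewrite phiz.
apply/word_functional_distribution => -[|x w].
  by rewrite ncmoment_nil u; have := phiE [::]; rewrite !big_nil.
rewrite sum_prod_colour ncmoment_cumulant // (eq_bnc_sum _ _ E) //.
rewrite -(sum_colourings (fun x => x) kap) //; apply: eq_bigr => eps _.
by rewrite phiE mE // size_codom card_ord.
Qed.

Lemma bifree_conv_pow_cumulant mu N nu : bifree_conv_pow mu N nu ->
  forall w, (0 < size w)%N -> nccumulant nu w = N%:R * nccumulant mu w.
Proof.
elim=> {N nu} [nu E|N rho nu _ IH c] w w0.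
  rewrite mul1r; move: w w0; apply: nccumulant_unique => w w0.
  by rewrite /ncmoment E; apply: ncmoment_cumulant.
by rewrite (bifree_conv_cumulant c) // IH // -natr1 mulrDl mul1r.
Qed.

Lemma bifree_conv_pow_of_cumulant mu N nu : mu 1 = 1 -> nu 1 = 1 ->
  (forall w, (0 < size w)%N -> nccumulant nu w = N.+1%:R * nccumulant mu w) ->
  bifree_conv_pow mu N.+1 nu.
Proof.
move=> u1; elim: N nu => [|N IH] nu u E.
  constructor; apply: eq_ncfunctional_cumulant; first by rewrite u.
  by move=> w w0; rewrite E // mul1r.
pose rho := cumulant_functional (fun w => N.+1%:R * nccumulant mu w).
have rhoE w : (0 < size w)%N -> nccumulant rho w = N.+1%:R * nccumulant mu w.
  by move=> w0; rewrite cumulant_functionalE.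
apply: (@bifree_conv_powS _ _ _ _ _ rho).
  by apply: IH rhoE; apply: cumulant_functional1.
apply: bifree_conv_of_cumulant => //; first exact: cumulant_functional1.
by move=> w w0; rewrite E // rhoE // -[N.+2%:R]natr1 mulrDl mul1r.
Qed.

Lemma compound_poisson_cumulant (lambda : R) mu nu :
  is_compound_bifree_poisson lambda mu nu ->
  forall w, (0 < size w)%N -> nccumulant nu w = lambda%:C%C * ncmoment mu w.
Proof.
case=> _ E w w0; rewrite /nccumulant /word_cumulant E // prod_codom codom_tnth.
by rewrite ncword_prod.
Qed.

Lemma compound_poisson_cumulant_functional (lambda : R) mu :
  is_compound_bifree_poisson lambda mu
    (cumulant_functional (fun w => lambda%:C%C * ncmoment mu w)).
Proof.
split=> [|n l n0]; first exact: cumulant_functional1.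
rewrite -(word_cumulant_codom (fun x => x)) -/(nccumulant _ _).
rewrite cumulant_functionalE ?size_codom ?card_ord //.
by rewrite prod_codom ncword_prod.
Qed.

(** * Positivity of compound Poisson functionals *)

Lemma ncstar_coef (P : ncpoly C K) (k : {fmonom K}) :
  (ncstar P)@_k = (P@_(FMonom (rev k)))^*.
Proof.
rewrite /ncstar raddf_sum /=.
under eq_bigr => w _ do rewrite mcoeffU.
have E (w : {fmonom K}) : (FMonom (rev w) == k) = (w == FMonom (rev k)).
  by rewrite !fmP /=; apply/eqP/eqP => [<-|->]; rewrite revK.
under eq_bigr => w _ do rewrite E.
have [kP|kP] := boolP (FMonom (rev k) \in msupp P); last first.
  rewrite (mcoeff_outdom kP) rmorph0 big_seq big1 // => w wP.
  by case: eqP => // wk; rewrite -wk wP in kP.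
rewrite (bigD1_seq (FMonom (rev k))) ?fset_uniq //= ?eqxx ?mulr1n big1 ?addr0 //.
by move=> w /negbTE->.
Qed.

Lemma ncstar_sum (s : seq (C * seq K)) :
  ncstar (\sum_(p <- s) p.1 *: ncword C p.2) =
  \sum_(p <- s) (p.1)^* *: ncword C (rev p.2).
Proof.
apply/malgP => k; rewrite ncstar_coef !raddf_sum ?rmorph_sum; apply: eq_bigr => p _ /=.
rewrite !mcoeffZ !mcoeffU rmorphM rmorph_nat; congr (_ * (nat_of_bool _)%:R).
by rewrite !fmP /=; apply/eqP/eqP => [->|<-]; rewrite revK.
Qed.

Lemma ncstar_mul_sum (s : seq (C * seq K)) mu :
  let Q := \sum_(p <- s) p.1 *: ncword C p.2 in
  mu (ncstar Q * Q) = hform (fun u v => ncmoment mu (rev u ++ v)) s.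
Proof.
move=> Q; rewrite ncstar_sum /Q mulr_suml linear_sum; apply: eq_bigr => p _ /=.
rewrite mulr_sumr linear_sum; apply: eq_bigr => q _ /=.
by rewrite -scalerAl -scalerAr scalerA linearZ /= ncwordM.
Qed.

Lemma Sigma_plus_psd mu :
  Sigma_plus mu <-> mu 1 = 1 /\ psd (fun u v => ncmoment mu (rev u ++ v)).
Proof.
split=> -[u1 pos]; split=> //.
  by move=> s; rewrite -(ncstar_mul_sum s mu); apply: pos.
move=> Q; have QE : Q =
    \sum_(p <- [seq (Q@_w, fmonom_val w) | w : {fmonom K} <- msupp Q])
       p.1 *: ncword C p.2.
  by rewrite big_map /= -ncword_sum.
by rewrite QE ncstar_mul_sum; apply: pos.
Qed.

(** The moments are the vacuum moments of the Fock space operators for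
    [c = lambda * mu]. *)
Lemma compound_poisson_pos (lambda : R) mu : 0 < lambda -> Sigma_plus mu ->
  Sigma_plus (cumulant_functional (fun w => lambda%:C%C * ncmoment mu w)).
Proof.
move=> l0 /Sigma_plus_psd[_ mu_pos].
apply/Sigma_plus_psd; split; first exact: cumulant_functional1.
pose c w := lambda%:C%C * ncmoment mu w.
have c_psd : psd (fun u v => c (rev u ++ v)).
  apply: eq_psd (psd_scale (fun _ => sqrtC lambda%:C%C) mu_pos) => u v /=.
  have lC : 0 <= lambda%:C%C :> C by rewrite lecR ltW.
  have -> : (sqrtC lambda%:C%C)^* = sqrtC lambda%:C%C.
    by apply/CrealP/ger0_real; rewrite sqrtC_ge0.
  by rewrite -expr2 sqrtCK.
pose lf (x : K) := if x is inl _ then true else false.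
apply: eq_psd (fock_moment_psd lf c_psd) => u v.
have E w : ncmoment (cumulant_functional c) w = fock_moment lf c w.
  rewrite -(codom_tnth w) -sum_BNC_fock; case: w => [|x w]; last first.
    by rewrite codom_tnth cumulant_functional_moment.
  rewrite codom_tnth ncmoment_nil cumulant_functional1.
  by rewrite sum_BNC_fock codom_tnth /fock_moment /= fock_gram_vac.
by rewrite E.
Qed.

End Functionals.

(** * Limits *)

Section Limits.
Variable F : numFieldType.
Implicit Types (u v : nat -> F) (a b : F).

Definition seq_cvg u a : Prop := (u @ \oo --> a)%classic.

Lemma seq_cvg_cst a : seq_cvg (fun=> a) a.
Proof. exact: cvg_cst. Qed.

Lemma seq_cvgD u v a b : seq_cvg u a -> seq_cvg v b ->
  seq_cvg (fun n => u n + v n) (a + b).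
Proof. exact: cvgD. Qed.

Lemma seq_cvgB u v a b : seq_cvg u a -> seq_cvg v b ->
  seq_cvg (fun n => u n - v n) (a - b).
Proof. exact: cvgB. Qed.

Lemma seq_cvgM u v a b : seq_cvg u a -> seq_cvg v b ->
  seq_cvg (fun n => u n * v n) (a * b).
Proof. exact: cvgM. Qed.

Lemma seq_cvgX u a m : seq_cvg u a -> seq_cvg (fun n => u n ^+ m) (a ^+ m).
Proof.
move=> ua; elim: m => [|m IH]; first exact: seq_cvg_cst.
rewrite exprS; under eq_fun do rewrite exprS.
exact: seq_cvgM.
Qed.

Lemma seq_cvg_sum (T : Type) (r : seq T) (P : pred T) (f : T -> nat -> F) (g : T -> F) :
  (forall i, P i -> seq_cvg (f i) (g i)) ->
  seq_cvg (fun n => \sum_(i <- r | P i) f i n) (\sum_(i <- r | P i) g i).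
Proof.
move=> H; elim: r => [|i r IH].
  by under eq_fun do rewrite big_nil; rewrite big_nil; apply: seq_cvg_cst.
under eq_fun do rewrite big_cons; rewrite big_cons.
by case: ifP => // Pi; apply: seq_cvgD => //; apply: H.
Qed.

Lemma seq_cvg_prod (T : Type) (r : seq T) (P : pred T) (f : T -> nat -> F) (g : T -> F) :
  (forall i, P i -> seq_cvg (f i) (g i)) ->
  seq_cvg (fun n => \prod_(i <- r | P i) f i n) (\prod_(i <- r | P i) g i).
Proof.
move=> H; elim: r => [|i r IH].
  by under eq_fun do rewrite big_nil; rewrite big_nil; apply: seq_cvg_cst.
under eq_fun do rewrite big_cons; rewrite big_cons.
by case: ifP => // Pi; apply: seq_cvgM => //; apply: H.
Qed.

Lemma seq_cvg_unique u a b : seq_cvg u a -> seq_cvg u b -> a = b.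
Proof. by move=> ua ub; apply: (cvg_unique (@norm_hausdorff F F) ua ub). Qed.

(** The order of the complex numbers is partial, so closedness of the nonnegative
    numbers comes from [0 <= x <-> x = `|x|] and continuity of the norm. *)
Lemma seq_cvg_ge0 u a : seq_cvg u a -> (forall n, 0 <= u n) -> 0 <= a.
Proof.
move=> ua u0; have := cvg_norm ua; under eq_fun do rewrite ger0_norm //.
move=> una; have -> : a = `|a| by exact: (seq_cvg_unique ua (una _)).
exact: normr_ge0.
Qed.

End Limits.

Lemma seq_cvg_harmonicC (R : realType) :
  @seq_cvg R[i] (fun n => n.+1%:R^-1) 0.
Proof.
apply/cvgrPdist_lt => -[re im]; rewrite ltcE /= => /andP[/eqP-> re0].
near=> n.
rewrite sub0r normrN ger0_norm ?invr_ge0 ?ler0n //.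
have -> : (n.+1%:R^-1 : R[i]) = (n.+1%:R^-1)%:C%C by rewrite fmorphV rmorph_nat.
rewrite ltcR; near: n.
exact: (near_infty_natSinv_lt (PosNum re0)).
Unshelve. all: by end_near.
Qed.

Section WordLimits.
Variables (R : realType) (I J : choiceType).
Local Notation C := R[i].
Local Notation K := (I + J)%type.
Local Notation bsum := (bnc_sum (fun x : K => x)).
Implicit Types (P : nat -> ncfunctional R I J) (nu : ncfunctional R I J).

Lemma weak_cvg_words P nu :
  weak_cvg P nu <->
  forall w, @seq_cvg C (fun n => ncmoment (P n) w) (ncmoment nu w).
Proof.
split=> [H w|H Q]; first exact: H.
suff : @seq_cvg C (fun n => P n Q) (nu Q) by [].
rewrite (linear_ncword nu); under eq_fun do rewrite linear_ncword.
by apply: seq_cvg_sum => w _; apply: seq_cvgM (H w); apply: seq_cvg_cst.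
Qed.

Lemma bnc_sum_cvg (kap : nat -> seq K -> C) (kap' : seq K -> C) w :
  (0 < size w)%N ->
  (forall v, (0 < size v)%N -> @seq_cvg C (fun n => kap n v) (kap' v)) ->
  @seq_cvg C (fun n => bsum (kap n) w) (bsum kap' w).
Proof.
move=> w0 H; rewrite /bnc_sum; apply: seq_cvg_sum => pi piB.
apply: seq_cvg_prod => V Vpi; apply: H; rewrite size_map -cardE card_gt0.
move: piB; rewrite BNC_boundary inE => /andP[/and3P[_ _ s0] _].
by apply: contraNneq s0 => <-.
Qed.

Lemma cumulant_rec_cvg (L : Type) (A : algType C) (phi : nat -> {scalar A})
    (psi : {scalar A}) (z : L -> A) (chi : L -> I + J) :
  (forall n (l : 'I_n -> L), @seq_cvg C (fun N => phi N (\prod_(k < n) z (l k)))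
                              (psi (\prod_(k < n) z (l k)))) ->
  forall m n (l : 'I_n -> L),
    @seq_cvg C (fun N => cumulant_rec (phi N) m (fun k => chi (l k)) (fun k => z (l k)))
                (cumulant_rec psi m (fun k => chi (l k)) (fun k => z (l k))).
Proof.
move=> H; elim=> [|m IH] n l /=; first exact: seq_cvg_cst.
apply: seq_cvgB; first exact: H.
apply: seq_cvg_sum => pi _; apply: seq_cvg_prod => V _.
exact: (IH _ (fun k => l (enum_val k))).
Qed.

Lemma nccumulant_cvg P nu : weak_cvg P nu ->
  forall w, @seq_cvg C (fun n => nccumulant (P n) w) (nccumulant nu w).
Proof.
move=> H w; rewrite /nccumulant /word_cumulant /cumulant.
apply: (@cumulant_rec_cvg K _ P nu (@ncX C _) (fun x => x)) => n l.
exact: H.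
Qed.

Lemma cumulant_functional_cvg (kap : nat -> seq K -> C) nu : nu 1 = 1 ->
  (forall w, (0 < size w)%N -> @seq_cvg C (fun n => kap n w) (nccumulant nu w)) ->
  weak_cvg (fun n => cumulant_functional (kap n)) nu.
Proof.
move=> u H; apply/weak_cvg_words => -[|x w].
  under eq_fun do rewrite ncmoment_nil cumulant_functional1.
  by rewrite ncmoment_nil u; apply: seq_cvg_cst.
under eq_fun do rewrite cumulant_functional_moment //.
by rewrite ncmoment_cumulant //; apply: bnc_sum_cvg.
Qed.

Lemma weak_cvg_pos P nu : (forall n, Sigma_plus (P n)) -> weak_cvg P nu ->
  Sigma_plus nu.
Proof.
move=> Ppos H; split; last first.
  by move=> Q; apply: (seq_cvg_ge0 (H _)) => n; case: (Ppos n).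
apply: (@seq_cvg_unique C (fun n => P n 1)); first exact: H.
by under eq_fun do rewrite (proj1 (Ppos _)); apply: seq_cvg_cst.
Qed.

(** A partition with [m] blocks contributes a multiple of [N * N^-m] to [N] times
    the moment: only the one-block partition survives in the limit. *)
Lemma root_moment_cvg (mu : nat -> ncfunctional R I J) (kap : seq K -> C) :
  (forall n w, (0 < size w)%N -> nccumulant (mu n) w = n.+1%:R^-1 * kap w) ->
  forall w, (0 < size w)%N ->
  @seq_cvg C (fun n => n.+1%:R * ncmoment (mu n) w) (kap w).
Proof.
move=> E w w0.
have -> : (fun n => n.+1%:R * ncmoment (mu n) w) =
  fun n => kap w + \sum_(pi in BNC (fun k => tnth (in_tuple w) k) |
          pi != [set [set: 'I_(size w)]])
     n.+1%:R^-1 ^+ #|pi|.-1 * \prod_(V in pi) kap [seq tnth (in_tuple w) k | k <- enum V].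
  apply/funext => n; have n0 : n.+1%:R != 0 :> C by rewrite pnatr_eq0.
  rewrite ncmoment_cumulant // bnc_sum_low // mulrDr E // mulVKf //; congr (_ + _).
  rewrite mulr_sumr; apply: eq_bigr => pi /andP[piB piT].
  have pi0 : (0 < #|pi|)%N.
    move: piB; rewrite BNC_boundary inE card_gt0 => /andP[/and3P[/eqP cov _ _] _].
    apply: contraTneq w0 => p0; rewrite -leqNgt -[X in (X <= _)%N]card_ord -cardsT -cov p0.
    by rewrite /cover big_set0 cards0.
  under eq_bigr => V Vpi.
    rewrite E; last first.
      by rewrite size_map -cardE; case/andP: (BNC_block piB piT Vpi).
    over.
  rewrite big_split /= prodr_const -{1}(prednK pi0) exprS -!mulrA mulVKf //.
rewrite -[X in seq_cvg _ X]addr0; apply: seq_cvgD; first exact: seq_cvg_cst.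
rewrite -[X in seq_cvg _ X](@big1_eq C 0 +%R _ (index_enum _)
   (fun pi => (pi \in BNC (fun k => tnth (in_tuple w) k)) &&
              (pi != [set [set: 'I_(size w)]]))).
apply: seq_cvg_sum => pi /andP[piB piT].
rewrite -(mul0r (\prod_(V in pi) kap [seq tnth (in_tuple w) k | k <- enum V])).
apply: seq_cvgM; last exact: seq_cvg_cst.
have pi2 : (1 < #|pi|)%N.
  rewrite ltnNge; apply/negP => pi1; move: (piB); rewrite BNC_boundary inE.
  case/andP => /and3P[/eqP cov _ _] _.
  have [V Vpi kV] : exists2 V, V \in pi & Ordinal w0 \in V.
    by apply/bigcupP; rewrite -/(cover pi) cov inE.
  have piV : pi = [set V].
    by apply/esym/eqP; rewrite eqEcard sub1set Vpi cards1.
  by move: piT; rewrite -cov piV /cover big_set1 eqxx.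
case: #|pi| pi2 => [//|[//|m]] _ /=.
have -> : 0 = 0 ^+ m.+1 :> C by rewrite expr0n.
exact/seq_cvgX/seq_cvg_harmonicC.
Qed.

End WordLimits.

Theorem theorem3p5 (R : realType) (I J : choiceType) (nu : ncfunctional R I J)
    (nu_pos : Sigma_plus nu) :
  bifree_infinitely_divisible nu <->
  exists (lambda : nat -> R) (mu P : nat -> ncfunctional R I J),
    (forall n, [/\ 0 < lambda n, Sigma_plus (mu n) &
       is_compound_bifree_poisson (lambda n) (mu n) (P n)]) /\
    weak_cvg P nu.
Proof.
have [nu1 _] := nu_pos; split.
  move=> div.
  have /choice[mu muP] (n : nat) : exists mu,
      Sigma_plus mu /\ bifree_conv_pow mu n.+1 nu.
    by have [mu] := div n.+1 isT; exists mu.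
  have muE n w : (0 < size w)%N ->
      nccumulant (mu n) w = n.+1%:R^-1 * nccumulant nu w.
    move=> w0; have [_ /bifree_conv_pow_cumulant E] := muP n.
    by rewrite (E w w0) mulKf // pnatr_eq0.
  exists (fun n => n.+1%:R), mu, (fun n => cumulant_functional
    (fun w => (n.+1%:R : R)%:C%C * ncmoment (mu n) w)).
  split=> [n|].
    split; [by rewrite ltr0n|by case: (muP n)|].
    exact: compound_poisson_cumulant_functional.
  apply: cumulant_functional_cvg => // w w0.
  by under eq_fun do rewrite rmorph_nat; apply: root_moment_cvg.
case=> lambda [mu [P [H cvgP]]] [//|N] _.
pose kap w := N.+1%:R^-1 * nccumulant nu w.
exists (cumulant_functional kap); last first.
  apply: bifree_conv_pow_of_cumulant => // [|w w0]; first exact: cumulant_functional1.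
  by rewrite cumulant_functionalE // mulVKf // pnatr_eq0.
pose r n := lambda n / N.+1%:R.
apply: (@weak_cvg_pos _ _ _
  (fun n => cumulant_functional (fun w => (r n)%:C%C * ncmoment (mu n) w))).
  move=> n; have [l0 mu_pos _] := H n; apply: compound_poisson_pos => //.
  by rewrite divr_gt0 // ltr0n.
apply: cumulant_functional_cvg => [|w w0]; first exact: cumulant_functional1.
rewrite cumulant_functionalE //.
have -> : (fun n => (r n)%:C%C * ncmoment (mu n) w) =
    fun n => N.+1%:R^-1 * nccumulant (P n) w.
  apply/funext => n; have [_ _ pois] := H n.
  rewrite (compound_poisson_cumulant pois) // /r rmorphM fmorphV rmorph_nat.
  by rewrite mulrA [_^-1 * _]mulrC.
by apply: seq_cvgM; [exact: seq_cvg_cst|exact: nccumulant_cvg].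
Qed.
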